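(* For $\lambda>0$ let $B(\lambda)$ be the number of bit comparisons used by Quicksort to sort $X_1,\dots,X_N$, where $X_1,X_2,\dots$ are independent and uniformly distributed on $(0,1)$ and $N$ is independent of them and Poisson distributed with mean $\lambda$. There exists a constant $c$ such that $\mathbf{Var}\,B(\lambda)\le c^2\lambda^2$ for $0<\lambda<\infty$.
   Context: Quicksort: to sort an array of $n$ distinct keys, if $n\le 1$ do nothing. If $n\ge 2$, pick a key uniformly at random from the array (independently of everything else), called the pivot; compare each of the other keys to the pivot, thereby partitioning the remaining keys into the subarray of smaller keys and the subarray of larger keys; then recursively apply Quicksort to each of the two subarrays. Bit comparisons: for distinct $x,y\in(0,1)$ let $b(x,y)\in\{1,2,\dots\}$ be the index of the first bit at which the binary expansions of $x$ and $y$ differ (using the terminating expansion for dyadic rationals). A comparison of the keys $x$ and $y$ costs $b(x,y)$ bit comparisons, and the number of bit comparisons required to sort a list of keys is the sum of $b(x,y)$ over all pairs of keys compared by Quicksort. *)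

(* Defs.v *)
From HB Require Import structures.
From mathcomp Require Import all_boot all_order all_algebra.
From mathcomp Require Import all_classical all_reals all_analysis.

Set Implicit Arguments.
Unset Strict Implicit.
Unset Printing Implicit Defensive.

Import Order.TTheory GRing.Theory Num.Theory.
Import numFieldNormedType.Exports.

Local Open Scope classical_set_scope.
Local Open Scope ring_scope.

Section BitComparisons.
Context {R : realType}.

(* For 0 < x < 1 the bits are numbered from k = 1, so that x is the sum of
   bit x k / 2 ^ k over k >= 1.  Because of the floor, dyadic rationals get
   their terminating expansion. *)
Definition bit (x : R) (k : nat) : bool := odd (Num.truncn (2 ^+ k * x)).

(* The value 0 when no bit differs is a junk value: it does not occur for
   distinct x, y in (0, 1). *)
Definition bit_cost (x y : R) : nat :=
  if pselect (exists k, (0 < k)%N && (bit x k != bit y k)) is left h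
  then ex_minn h else 0%N.

End BitComparisons.

Section Quicksort.
Context {R : realType}.

(* A recursive call of Quicksort is addressed by a word w in {false, true}*:
   the path from the root of the tree of calls, read from the root, where
   false (resp. true) stands for the subarray of smaller (resp. larger) keys.
   If that call is made on an array of n >= 2 keys, its pivot is the key in
   position J w n (counted from 0).  When J w n is out of range the pivot is
   the first key, so that the recursion always terminates.
   The result lists the pairs (key, pivot) that get compared; m only bounds
   the recursion depth, and the size of the array suffices (comparisonsE). *)
Fixpoint comparisons_rec (m : nat) (J : seq bool -> nat -> nat) (s : seq R) :
    seq (R * R) :=
  if m is m'.+1 then
    if (size s <= 1)%N then [::] else
    let p := nth (head 0 s) s (J [::] (size s)) in
    [seq (x, p) | x <- s & x != p]
    ++ comparisons_rec m' (fun w => J (false :: w)) [seq x <- s | x < p]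
    ++ comparisons_rec m' (fun w => J (true :: w)) [seq x <- s | p < x]
  else [::].

Definition comparisons (J : seq bool -> nat -> nat) (s : seq R) :
    seq (R * R) :=
  comparisons_rec (size s) J s.

Definition bit_comparisons (J : seq bool -> nat -> nat) (s : seq R) : nat :=
  (\sum_(c <- comparisons J s) bit_cost c.1 c.2)%N.

Lemma comparisons_recE m J s : (size s <= m)%N ->
  comparisons_rec m J s = comparisons J s.
Proof.
rewrite /comparisons.
have [k] := ubnP m; elim: k m J s => // k IH [|m] J s /=.
  by move=> _; rewrite leqn0 => /nilP ->.
rewrite ltnS => mk sm; case: s sm => [//|x0 s] sm /=.
case: ifP => // /negbT; rewrite -ltnNge => s1.
set p := nth _ _ _.
have ps : p \in x0 :: s.
  rewrite /p; have [h|h] := ltnP (J [::] (size s).+1) (size (x0 :: s)).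
    exact: mem_nth.
  by rewrite nth_default// mem_head.
have lt_size (a : pred R) : a p = false -> (size (seq.filter a (x0 :: s)) <= size s)%N.
  move=> ap; rewrite size_filter -ltnS -[(size s).+1]/(size (x0 :: s)).
  rewrite -(count_predC a (x0 :: s)) -addn1 leq_add2l -has_count.
  by apply/hasP; exists p => //=; rewrite ap.
have H (a : pred R) J' : a p = false ->
    comparisons_rec m J' (seq.filter a (x0 :: s))
    = comparisons_rec (size s) J' (seq.filter a (x0 :: s)).
  move=> ap; have h := lt_size a ap.
  rewrite (IH m)// ?(leq_trans h)// (IH (size s))//.
  exact: leq_ltn_trans _ mk.
congr (_ ++ _); congr (_ ++ _); first exact: (H (fun x => x < p) _ (ltxx p)).
exact: (H (fun x => p < x) _ (ltxx p)).
Qed.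

Lemma comparisonsE J s : comparisons J s =
  if (size s <= 1)%N then [::] else
  let p := nth (head 0 s) s (J [::] (size s)) in
  [seq (x, p) | x <- s & x != p]
  ++ comparisons (fun w => J (false :: w)) [seq x <- s | x < p]
  ++ comparisons (fun w => J (true :: w)) [seq x <- s | p < x].
Proof.
rewrite -(@comparisons_recE (size s).+1)//=; case: ifP => // _.
by rewrite !comparisons_recE// size_filter count_size.
Qed.

End Quicksort.

Section Probability.
Context {d : measure_display} {T : measurableType d} {R : realType}.
Variable P : probability T R.

(* Mutual independence of a family of classes of events. *)
Definition independent_classes (I : choiceType) (G : I -> set (set T)) : Prop :=
  forall (s : seq I) (E : I -> set T), uniq s ->
    (forall i, i \in s -> G i (E i)) ->
    P (\bigcap_(i in [set` s]) E i) = (\prod_(i <- s) P (E i))%E.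

Definition uniform01 (X : {RV P >-> R}) : Prop :=
  forall A : set R, measurable A ->
    distribution P X A = uniform_prob (@ltr01 R) A.

Definition poisson_distributed (rate : R) (N : {RV P >-> nat}) : Prop :=
  forall k : nat, P (N @^-1` [set k]) = (poisson_pmf rate k)%:E.

Definition uniform_ord (n : nat) (V : {RV P >-> nat}) : Prop :=
  forall i : nat, (i < n)%N -> P (V @^-1` [set i]) = (n%:R^-1)%:E.

(* The sigma-algebras generated by the number N of keys, by the keys X i and
   by the pivot positions J w n, put together in a single family. *)
Definition sources (N : {RV P >-> nat}) (X : nat -> {RV P >-> R})
    (J : seq bool -> nat -> {RV P >-> nat})
    (i : unit + nat + seq bool * nat) : set (set T) :=
  match i with
  | inl (inl _) => g_sigma_algebra_preimage N
  | inl (inr k) => g_sigma_algebra_preimage (X k)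
  | inr (w, n) => g_sigma_algebra_preimage (J w n)
  end.

(* B(lambda): the keys are X 0, ..., X (N - 1). *)
Definition quicksort_bit_comparisons (N : {RV P >-> nat})
    (X : nat -> {RV P >-> R}) (J : seq bool -> nat -> {RV P >-> nat})
    (t : T) : R :=
  (bit_comparisons (fun w n => J w n t) (mkseq (fun i => X i t) (N t)))%:R.

End Probability.

(* Main.v *)
Require Import Defs.
From HB Require Import structures.
From mathcomp Require Import all_boot all_order all_algebra.
From mathcomp Require Import all_classical all_reals all_analysis.
From mathcomp Require Import measurable_realfun ring lra zify.

(** Let B_k count the compared pairs of keys that agree in their first k bits, so
that B = \sum_k B_k.  Given the keys, the restriction of Quicksort to a dyadic
interval holding n keys costs mu(n) = 2 (n + 1) H_n - 4 n comparisons on average,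
and a martingale argument along the recursion bounds the conditional variance of
B_k by 75 \sum_I n_I (n_I - 1) over the intervals I of length 2^-k.  Revealing the
keys one at a time bounds the variance of \sum_I mu(n_I) given N = n by
12 2^-k n (n - 1), because (mu(n + 1) - mu(n))^2 <= 12 n.  Finally the mean f_k(n)
satisfies (f_k(n + 1) - f_k(n))^2 <= 12 2^-k n, so f_k(N) deviates from
f_k(floor lambda) by O(2^-k lambda^2) in mean square.  Altogether the mean square
deviation of B_k from f_k(floor lambda) is at most 207 2^-k lambda^2, and a
weighted Cauchy-Schwarz inequality sums this over k.

All of this is computed for keys rounded to the cells of level L, with ties broken
by index, where only finitely many events matter and the independence hypothesis
applies directly; almost surely the rounded cost equals B for large L, and Fatou's
lemma concludes. *)

(** Each stage bounds a mean square distance to an arbitrary number [b], and not a variance: it is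
    at most a fluctuation term plus the squared distance of the conditional mean to the same [b].
    The stages for the pivots, the keys and N therefore compose, and [b] is chosen only at the end.
    A bound of order lambda^2 leaves no room, for small lambda, for terms of order lambda; this is
    why the bounds on squared increments vanish at n = 0. In the sum over k the weights have to grow
    more slowly than 2^k: (3/2)^k against 2^-k leaves the summable (3/4)^k. *)

Set Implicit Arguments.
Unset Strict Implicit.
Unset Printing Implicit Defensive.

Import Order.TTheory GRing.Theory Num.Theory.
Import numFieldNormedType.Exports.

Local Open Scope classical_set_scope.
Local Open Scope ring_scope.

(** * Expected comparison counts *)

Section MeanCost.
Context {R : realType}.
Implicit Types n a i j : nat.

Definition harm n : R := \sum_(i < n) i.+1%:R^-1.

(* The mean number of comparisons Quicksort makes on [n] keys. *)
Definition mean_cost n : R := 2 * n.+1%:R * harm n - 4 * n%:R.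

(* The excess of the mean cost for [a] keys once the pivot has rank [j]. *)
Definition delta a j : R := a.-1%:R + mean_cost j + mean_cost (a.-1 - j) - mean_cost a.

Lemma harmS n : harm n.+1 = harm n + n.+1%:R^-1.
Proof. by rewrite /harm big_ord_recr. Qed.

Lemma harm_ge0 n : 0 <= harm n.
Proof. by apply: sumr_ge0 => i _; rewrite invr_ge0. Qed.

Lemma harm_le n : harm n <= n%:R.
Proof.
elim: n => [|n IH]; first by rewrite /harm big_ord0.
by rewrite harmS -[n.+1%:R in leRHS]natr1 lerD// invf_le1// ler1n.
Qed.

Lemma le_harm i n : (i <= n)%N -> harm i <= harm n.
Proof.
move=> /subnK <-; elim: (n - i)%N => // m; rewrite addSn harmS => /le_trans; apply.
by rewrite lerDl invr_ge0.
Qed.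

Lemma mean_cost0 : mean_cost 0 = 0.
Proof. by rewrite /mean_cost /harm big_ord0 !mulr0 subr0. Qed.

Lemma mean_costS n : mean_cost n.+1 - mean_cost n = 2 * harm n - 2 * n%:R / n.+1%:R.
Proof.
rewrite /mean_cost harmS -natr1 -[n.+1%:R]natr1; have n0 : (n%:R + 1 : R) != 0 by rewrite natr1.
by field.
Qed.

Lemma harm_gt_ratio n : n%:R / n.+1%:R <= harm n.
Proof.
rewrite mulr_natl -[X in _ *+ X](card_ord n) -sumr_const.
by apply: ler_sum => i _; rewrite lef_pV2 ?posrE// ler_nat ltnS ltnW.
Qed.

Lemma harm_sqr n : harm n ^+ 2 <= 3 * n%:R.
Proof.
elim: n => [|n IH]; first by rewrite /harm big_ord0 expr0n mulr0.
rewrite harmS -[n.+1%:R in leRHS]natr1.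
have h1 : harm n * n.+1%:R^-1 <= 1.
  by rewrite ler_pdivrMr// mul1r (le_trans (harm_le n))// ler_nat.
have h2 : n.+1%:R^-1 <= 1 :> R by rewrite invf_le1// ler1n.
have h3 : 0 <= n.+1%:R^-1 :> R by rewrite invr_ge0.
have h4 : n.+1%:R^-1 ^+ 2 <= 1 :> R by rewrite expr_le1.
by move: IH h1 h4; set h := harm n; set r := _^-1; nra.
Qed.

(** The increment lies between 0 and 2 H_n, and H_n^2 <= 3 n. Giving away the logarithm keeps every
    later bound polynomial in n. *)
Lemma sqr_diff_mean_cost n : (mean_cost n.+1 - mean_cost n) ^+ 2 <= 12 * n%:R.
Proof.
rewrite mean_costS -mulrA; have h1 := harm_gt_ratio n; have h2 := harm_sqr n.
have h3 : 0 <= n%:R / n.+1%:R :> R by rewrite divr_ge0.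
by move: h1 h2 h3; set h := harm n; set t := n%:R / _; nra.
Qed.

(** The Quicksort recurrence for the mean, multiplied by n so that it also covers n = 0. *)
Lemma sum_mean_cost n : n%:R * mean_cost n = n%:R * n.-1%:R + 2 * \sum_(j < n) mean_cost j.
Proof.
elim: n => [|n IH]; first by rewrite !mul0r big_ord0 mulr0 addr0.
rewrite big_ord_recr/= [2 * (_ + _)]mulrDr addrA.
have -> : 2 * \sum_(i < n) mean_cost i = n%:R * mean_cost n - n%:R * n.-1%:R by rewrite IH addrC addKr.
have -> : mean_cost n.+1 = mean_cost n + (2 * harm n - 2 * n%:R / n.+1%:R) by rewrite -mean_costS addrC subrK.
have -> : n%:R * n.-1%:R = n%:R * (n%:R - 1) :> R.
  by case: n {IH} => [|n]; rewrite ?mul0r// -[n.+1%:R]natr1 addrK.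
rewrite /mean_cost -[n.+1%:R]natr1; have n0 : (n%:R + 1 : R) != 0 by rewrite natr1.
by field.
Qed.

Lemma sum_delta a : \sum_(j < a) delta a j = 0.
Proof.
rewrite /delta sumrB big_split/= big_split/= !sumr_const !card_ord.
rewrite -(mulr_natl (mean_cost a)) sum_mean_cost -mulr_natl.
have -> : \sum_(i < a) mean_cost (a.-1 - i) = \sum_(i < a) mean_cost i.
  rewrite (reindex_inj rev_ord_inj)/=; apply: eq_bigr => i _; congr mean_cost.
  by have := ltn_ord i; lia.
ring.
Qed.

Lemma mul_harm_sub i m : i%:R * (harm (i + m) - harm i) <= m%:R.
Proof.
elim: m => [|m IH]; first by rewrite addn0 subrr mulr0.
rewrite addnS harmS addrAC mulrDr -[m.+1%:R in leRHS]natr1 lerD//.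
by rewrite ler_pdivrMr// mul1r ler_nat ltnW// ltnS leq_addr.
Qed.

(** With n = a - 1 = i + j, the terms of order n log n combine into -2 (i (H_n - H_i) + j (H_n -
    H_j)), which lies between -2 n and 0 by [mul_harm_sub]. The rest is controlled by H_n <= n,
    which gives the factor 5. *)
Lemma sqr_delta a j : (j < a)%N -> delta a j ^+ 2 <= 25 * a.-1%:R ^+ 2.
Proof.
case: a => // n; rewrite ltnS /delta/= => jn.
have [i ->] : exists i, n = (i + j)%N by exists (n - j)%N; rewrite subnK.
rewrite addnK {jn n}; set n := (i + j)%N.
have mE k : mean_cost k = 2 * (k%:R * harm k) + 2 * harm k - 4 * k%:R.
  by rewrite /mean_cost -natr1; ring.
have nE : n%:R = i%:R + j%:R :> R by rewrite natrD.
have dE : mean_cost n.+1 = mean_cost n + (2 * harm n - 2 * n%:R / n.+1%:R) by rewrite -mean_costS addrC subrK.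
have h1 := mul_harm_sub i j; have h2 := mul_harm_sub j i.
rewrite addnC -/n in h2; rewrite -/n in h1.
have h3 : harm i <= harm n by apply: le_harm; rewrite leq_addr.
have h4 : harm j <= harm n by apply: le_harm; rewrite leq_addl.
have h5 : 0 <= i%:R * (harm n - harm i) by rewrite mulr_ge0// subr_ge0.
have h6 : 0 <= j%:R * (harm n - harm j) by rewrite mulr_ge0// subr_ge0.
have h7 := harm_le n; have h8 := harm_ge0 i; have h9 := harm_ge0 j.
have h10 := harm_gt_ratio n.
have h11 : 0 <= n%:R / n.+1%:R :> R by rewrite divr_ge0.
rewrite dE !mE; rewrite !mulrBr in h1 h2 h5 h6; rewrite -!mulrA.
have nhE : n%:R * harm n = i%:R * harm n + j%:R * harm n by rewrite nE mulrDl.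
rewrite nhE; have hi0 : 0 <= i%:R :> R by []; have hj0 : 0 <= j%:R :> R by [].
move: h1 h2 h3 h4 h5 h6 h7 h8 h9 h10 h11; rewrite nE.
set t := (_ + _) / _; set x1 := i%:R * harm n; set x2 := i%:R * _; set x3 := j%:R * harm n.
set x4 := j%:R * _ => h1 h2 h3 h4 h5 h6 h7 h8 h9 h10 h11.
set D := (X in X ^+ 2).
have hl : - (5 * (i%:R + j%:R)) <= D by rewrite /D; lra.
have hu : D <= 5 * (i%:R + j%:R) by rewrite /D; lra.
nra.
Qed.

(* 75 makes the variance recursion [sum_sqr_delta_var_bound] close: each
   [delta a j ^+ 2] is at most [25 (a - 1) ^+ 2]. *)
Definition var_bound a : R := 75 * a%:R * (a%:R - 1).

Lemma sum_var_bound a : \sum_(j < a) var_bound j = 25 * a%:R * (a%:R - 1) * (a%:R - 2).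
Proof.
elim: a => [|a IH]; first by rewrite big_ord0 mulr0 !mul0r.
by rewrite big_ord_recr/= IH /var_bound -[a.+1%:R]natr1; ring.
Qed.

(** The two subarrays take two thirds of the leading coefficient 75; the remaining third pays for
    the 25 of [sqr_delta]. *)
Lemma sum_sqr_delta_var_bound a :
  \sum_(j < a) (delta a j ^+ 2 + var_bound j + var_bound (a.-1 - j)) <= a%:R * var_bound a.
Proof.
case: a => [|n]; first by rewrite big_ord0 mul0r.
rewrite big_split/= big_split/=.
have -> : \sum_(j < n.+1) var_bound (n - j) = \sum_(j < n.+1) var_bound j.
  rewrite (reindex_inj rev_ord_inj)/=; apply: eq_bigr => i _; congr var_bound.
  by have := ltn_ord i; lia.
have h : \sum_(j < n.+1) delta n.+1 j ^+ 2 <= n.+1%:R * (25 * n%:R ^+ 2).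
  rewrite mulr_natl -[X in _ *+ X](card_ord n.+1) -sumr_const.
  by apply: ler_sum => i _; apply: sqr_delta.
rewrite sum_var_bound /var_bound; move: h; rewrite -[n.+1%:R]natr1.
have : 0 <= n%:R :> R by []; set S := \sum_(_ < _) _; set x := n%:R; nra.
Qed.

End MeanCost.

(** * Costs under random pivots *)

Section PivotLaw.
Context {R : realType}.
Implicit Types (f : R -> R -> nat) (s : seq R) (phi psi : nat -> R) (m : nat).

Definition total_cost f m (J : seq bool -> nat -> nat) s : nat :=
  (\sum_(c <- comparisons_rec m J s) f c.1 c.2)%N.

Lemma total_costS f m J s : (1 < size s)%N ->
  let p := nth (head 0 s) s (J [::] (size s)) in
  total_cost f m.+1 J s = (\sum_(x <- s | x != p) f x p +
   (total_cost f m (fun w => J (false :: w)) [seq x <- s | (x < p)%R] +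
    total_cost f m (fun w => J (true :: w)) [seq x <- s | (p < x)%R]))%N.
Proof.
move=> s1 p; rewrite /total_cost /= leqNgt s1/= !big_cat/= big_map big_filter.
by [].
Qed.

Lemma total_cost_small f m J s : (size s <= 1)%N -> total_cost f m J s = 0%N.
Proof. by case: m => [|m] s1; rewrite /total_cost/= ?s1 big_nil. Qed.

Lemma pivot_mem s i : (1 < size s)%N -> nth (head 0 s) s i \in s.
Proof.
case: s => // x s _ /=; have [h|h] := ltnP i (size (x :: s)); first exact: mem_nth.
by rewrite nth_default// mem_head.
Qed.

Lemma size_filter_lt s (a : pred R) p : p \in s -> ~~ a p ->
  (size [seq x <- s | a x] < size s)%N.
Proof.
move=> ps ap; rewrite size_filter -(count_predC a s) -[X in (X < _)%N]addn0 ltn_add2l.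
by rewrite -has_count; apply/hasP; exists p.
Qed.

Lemma size_split_lt s p : p \in s ->
  (size [seq x <- s | (x < p)%R] + size [seq x <- s | (p < x)%R] < size s)%N.
Proof.
move=> ps; rewrite !size_filter -(count_predUI (fun x => x < p) (fun x => (p < x)%R)).
rewrite (@eq_count _ (predI _ _) pred0); last first.
  by move=> x /=; apply/negP => /andP[/lt_trans h /h]; rewrite ltxx.
rewrite count_pred0 addn0 -size_filter; apply: (size_filter_lt ps).
by rewrite /= ltxx.
Qed.

(* The expectation of [phi] at the cost of sorting [s] with independent uniform
   pivots. *)
Fixpoint law f m s phi {struct m} : R :=
  if m is m'.+1 then
    if (size s <= 1)%N then phi 0%N else
    (size s)%:R^-1 * \sum_(i < size s)
      let p := nth (head 0 s) s i in
      law f m' [seq x <- s | x < p] (fun a =>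
      law f m' [seq x <- s | p < x] (fun b =>
        phi (\sum_(x <- s | x != p) f x p + (a + b))%N))
  else phi 0%N.

Lemma eq_law f m s phi psi : phi =1 psi -> law f m s phi = law f m s psi.
Proof. by move=> /funext ->. Qed.

Lemma law_small f m s phi : (size s <= 1)%N -> law f m s phi = phi 0%N.
Proof. by case: m => //= m ->. Qed.

Lemma law_le f m s phi psi : (forall d, phi d <= psi d) -> law f m s phi <= law f m s psi.
Proof.
elim: m s phi psi => [|m IH] s phi psi le_phi //=; case: ifP => // _.
rewrite ler_wpM2l// ?invr_ge0//; apply: ler_sum => i _.
by apply: (IH) => a; apply: IH => b.
Qed.

Lemma law_cst f m s c : law f m s (fun=> c) = c.
Proof.
elim: m s c => [|m IH] s c //=; case: ifPn => //; rewrite -ltnNge => s1.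
rewrite (eq_bigr (fun=> c)) => [|i _]; last first.
  by rewrite -[RHS](IH [seq x <- s | x < nth (head 0 s) s i]); apply: eq_law => a; exact: IH.
rewrite sumr_const card_ord -[c *+ _]mulr_natl mulKf// pnatr_eq0 -lt0n.
exact: ltnW.
Qed.

Lemma lawD f m s phi psi :
  law f m s (fun d => phi d + psi d) = law f m s phi + law f m s psi.
Proof.
elim: m s phi psi => [|m IH] s phi psi //=; case: ifPn => // _.
rewrite -mulrDr -big_split/=; congr (_ * _); apply: eq_bigr => i _.
by rewrite -IH; apply: eq_law => a; rewrite -IH.
Qed.

Lemma lawZ f m s phi c : law f m s (fun d => c * phi d) = c * law f m s phi.
Proof.
elim: m s phi => [|m IH] s phi //=; case: ifPn => // _.
rewrite [RHS]mulrCA; congr (_ * _); rewrite mulr_sumr; apply: eq_bigr => i _.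
by rewrite -IH; apply: eq_law => a; rewrite -IH.
Qed.

Lemma law_sum f m s (I : Type) (r : seq I) (P : pred I) (phi : I -> nat -> R) :
  law f m s (fun d => \sum_(i <- r | P i) phi i d) = \sum_(i <- r | P i) law f m s (phi i).
Proof.
elim: r => [|i r IH].
  rewrite big_nil -[RHS](law_cst f m s 0).
  by apply: eq_law => d; rewrite big_nil.
rewrite big_cons -IH; case: ifPn => Pi.
  by rewrite -lawD; apply: eq_law => d; rewrite big_cons Pi.
by apply: eq_law => d; rewrite big_cons (negbTE Pi).
Qed.

(** The cost never exceeds [size s ^ 2], because the two subarrays together have fewer than [size s]
    keys. *)
Lemma eq_law_le f m s phi psi : (forall x y, f x y <= 1)%N ->
  (forall d, (d <= size s ^ 2)%N -> phi d = psi d) -> law f m s phi = law f m s psi.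
Proof.
move=> f1; elim: m s phi psi => [|m IH] s phi psi e /=; first exact: e.
case: ifPn => s1; first exact: e.
rewrite -ltnNge in s1; congr (_ * _); apply: eq_bigr => i _; apply: (IH) => a ha; apply: IH => b hb.
apply: e; set p := nth _ _ _ in ha hb *; have ps : p \in s by exact: pivot_mem.
have := size_split_lt ps; move: ha hb.
set k := size _; set l := size _ => ha hb kl.
have h : (\sum_(x <- s | x != p) f x p <= (size s).-1)%N.
  apply: (@leq_trans (\sum_(x <- s | x != p) 1)); first exact: leq_sum.
  rewrite sum1_count -size_filter -ltnS prednK//; last exact: ltnW.
  by apply: (size_filter_lt ps); rewrite /= eqxx.
move: h; set t := (\sum_(_ <- _ | _) _)%N; nia.
Qed.

Lemma total_cost_le f m J' (s : seq R) : (forall x y, f x y <= 1)%N ->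
  (total_cost f m J' s <= size s ^ 2)%N.
Proof.
move=> f1; elim: m J' s => [|m IH] J' s; first by rewrite /total_cost big_nil.
have [s1|s1] := leqP (size s) 1; first by rewrite total_cost_small.
rewrite total_costS//; set p := nth _ _ _; have ps : p \in s by exact: pivot_mem.
move: (size_split_lt ps) (IH (fun w => J' (false :: w)) [seq x <- s | (x < p)%R])
  (IH (fun w => J' (true :: w)) [seq x <- s | (p < x)%R]).
set k := size _; set l := size _; set a := total_cost _ _ _ _; set b := total_cost _ _ _ _.
move=> kl ak bl.
have h : (\sum_(x <- s | x != p) f x p <= (size s).-1)%N.
  apply: (@leq_trans (\sum_(x <- s | x != p) 1)); first exact: leq_sum.
  rewrite sum1_count -size_filter -ltnS prednK//; last exact: ltnW.
  by apply: (size_filter_lt ps); rewrite /= eqxx.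
move: h; set t := (\sum_(_ <- _ | _) _)%N. nia.
Qed.

(** Reduces [law] to point masses, the form in which it can be matched with probabilities of
    events. *)
Lemma law_expand f m (s : seq R) (F : nat -> R) n : (forall x y, f x y <= 1)%N ->
  (size s ^ 2 < n)%N ->
  law f m s F = \sum_(a < n) F a * law f m s (fun x => (x == a)%:R).
Proof.
move=> f1 sn; under eq_bigr do rewrite -lawZ.
rewrite -law_sum; apply: eq_law_le => // x xs.
rewrite (bigD1 (Ordinal (leq_ltn_trans xs sn)))//= eqxx mulr1 big1 ?addr0// => i ix.
rewrite (_ : (x == i) = false) ?mulr0//.
by apply: contra_neqF ix => /eqP xi; exact: val_inj.
Qed.

End PivotLaw.

(** * Counting only comparisons inside classes of keys *)

Section ClassCost.
Context {R : realType}.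
Variables (kappa : R -> nat) (K : nat).
Hypothesis le_kappa : {homo kappa : x y / x <= y >-> (x <= y)%N}.
Implicit Types (s t : seq R) (g : nat -> R).

Definition same_class (x y : R) : nat := kappa x == kappa y.

Definition class_size I s := count (fun x => kappa x == I) s.

Definition class_sum g s := \sum_(I < K) g (class_size I s).

Lemma sum_rank h t : uniq t ->
  \sum_(p <- t) h (count (fun x => x < p) t) = \sum_(j < size t) h j :> R.
Proof.
move=> ut; pose t' := sort <=%R t.
have pt : perm_eq t' t by rewrite perm_sort.
rewrite -(perm_big _ pt)/= -(perm_size pt).
under eq_bigr do rewrite -(permP pt).
have: sorted <%R t' by rewrite lt_sorted_uniq_le sort_uniq ut sort_le_sorted.
elim: t' {pt} h => [|x v IH] h st; first by rewrite big_nil big_ord0.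
have xt y : y \in v -> x < y.
  by move: st => /= /(order_path_min lt_trans)/allP; apply.
rewrite big_cons/= ltxx/= add0n big_ord_recl; congr (_ + _).
  rewrite (_ : count _ _ = 0%N)//; apply/eqP; rewrite -leqn0 leqNgt -has_count.
  by apply/hasPn => y /xt /ltW; rewrite leNgt.
rewrite -(IH (fun j => h j.+1)); last exact: path_sorted st.
by apply: eq_big_seq => p /xt ->.
Qed.

Definition class_rank s p := count (fun x => (kappa x == kappa p) && (x < p)) s.

(** Given its class, a uniform pivot has a uniform rank in that class. The average over pivots thus
    becomes one sum per class, where [sum_delta] applies. *)
Lemma sum_class_rank (H : nat -> nat -> R) s : uniq s ->
  (forall x, x \in s -> (kappa x < K)%N) ->
  \sum_(p <- s) H (class_size (kappa p) s) (class_rank s p) =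
  \sum_(I < K) \sum_(j < class_size I s) H (class_size I s) j.
Proof.
move=> us sK.
transitivity (\sum_(p <- s) \sum_(I < K | kappa p == I)
    H (class_size (kappa p) s) (class_rank s p)).
  apply: eq_big_seq => p /sK pK; by rewrite (big_pred1 (Ordinal pK)).
rewrite (exchange_big_dep predT)//=; apply: eq_bigr => I _.
rewrite -[class_size I s]size_filter -(sum_rank _ (filter_uniq _ us)) big_filter.
rewrite big_seq_cond [RHS]big_seq_cond; apply: eq_bigr => p /andP[_ /eqP pI].
rewrite pI size_filter; congr H; rewrite /class_rank count_filter.
by apply: eq_count => x /=; rewrite pI andbC.
Qed.

(* Classes are intervals, so a pivot only splits its own class and leaves every
   other class on one side. *)
Lemma class_sum_split g s p : g 0%N = 0 -> uniq s -> p \in s -> (kappa p < K)%N ->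
  let a := class_size (kappa p) s in let j := class_rank s p in
  class_sum g [seq x <- s | x < p] + class_sum g [seq x <- s | p < x] =
  class_sum g s - g a + g j + g (a.-1 - j)%N.
Proof.
move=> g0 us ps pK a j; rewrite /class_sum -big_split/=.
rewrite (bigD1 (Ordinal pK))//= [X in _ = X - _ + _ + _](bigD1 (Ordinal pK))//= -/a.
have -> : class_size (kappa p) [seq x <- s | x < p] = j.
  by rewrite /class_size count_filter.
have -> : class_size (kappa p) [seq x <- s | p < x] = (a.-1 - j)%N.
  have aE : a = (j + count_mem p s + class_size (kappa p) [seq x <- s | (p < x)%R])%N.
    rewrite /j /class_rank /class_size count_filter /a /class_size {a j pK ps us}.
    elim: s => //= x s ->.
    by case: (ltgtP x p) => [xp|xp|->]; rewrite ?eqxx/= ?andbF ?andbT; lia.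
  rewrite (count_uniq_mem p us) ps in aE.
  by rewrite aE; lia.
under eq_bigr => I Ip.
  rewrite (_ : g _ + g _ = g (class_size I s)); first over.
  rewrite /class_size !count_filter; case: (ltngtP I (kappa p)) => [Ilt|Igt|Ie].
  - rewrite [X in _ + g X](_ : _ = 0%N) ?g0 ?addr0.
      congr g; apply: eq_count => x /=; apply: andb_idr => /eqP xI.
      by rewrite ltNge; apply/negP => /le_kappa; rewrite xI leqNgt Ilt.
    apply/eqP; rewrite -leqn0 leqNgt -has_count; apply/hasPn => x _ /=.
    by apply/negP => /andP[/eqP xI /ltW /le_kappa]; rewrite xI leqNgt Ilt.
  - rewrite [X in g X + _](_ : _ = 0%N) ?g0 ?add0r.
      congr g; apply: eq_count => x /=; apply: andb_idr => /eqP xI.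
      by rewrite ltNge; apply/negP => /le_kappa; rewrite xI leqNgt Igt.
    apply/eqP; rewrite -leqn0 leqNgt -has_count; apply/hasPn => x _ /=.
    by apply/negP => /andP[/eqP xI /ltW /le_kappa]; rewrite xI leqNgt Igt.
  - by move: Ip; rewrite -val_eqE/= -Ie eqxx.
ring.
Qed.

Lemma class_size_small s I : (size s <= 1)%N -> (class_size I s <= 1)%N.
Proof. by apply: leq_trans; exact: count_size. Qed.

(* Since the excesses [delta] average to 0, the square of a sum over classes
   picks up no cross terms: independence between classes is never needed. *)
Lemma law_sqr_le m s b : uniq s -> (forall x, x \in s -> (kappa x < K)%N) -> (size s <= m)%N ->
  law same_class m s (fun d => (d%:R - b) ^+ 2) <=
  class_sum var_bound s + (class_sum mean_cost s - b) ^+ 2.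
Proof.
have small t : (size t <= 1)%N -> class_sum var_bound t = 0 /\ class_sum mean_cost t = 0.
  move=> t1; split; apply: big1 => I _; move: (class_size_small I t1);
    case: class_size => [|[|]]//.
  - by rewrite /var_bound mulr0 mul0r.
  - by rewrite /var_bound subrr mulr0.
  - by rewrite mean_cost0.
  - by move=> _; rewrite /mean_cost /harm big_ord1 invr1; ring.
elim: m s b => [|m IH] s b us sK sm.
  rewrite leqn0 in sm; have [|-> ->] := small s; first by rewrite (eqP sm).
  by rewrite add0r.
rewrite /=; case: ifPn => s1.
  have [-> ->] := small s s1.
  by rewrite !add0r.
rewrite -ltnNge in s1; rewrite ler_pdivrMl ?ltr0n; last exact: ltnW.
(* The bound obtained after a pivot: it depends on the pivot only through the size [a] of its class
   and its rank [j] there. *)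
pose H a j : R := class_sum var_bound s - var_bound a + var_bound j + var_bound (a.-1 - j) + (class_sum mean_cost s + delta a j - b) ^+ 2.
apply: (@le_trans _ _ (\sum_(p <- s) H (class_size (kappa p) s) (class_rank s p))).
  rewrite [leRHS](big_nth (head 0 s)) big_mkord; apply: ler_sum => i _.
  set p := nth _ _ _; have ps : p \in s by exact: pivot_mem.
  have szl : (size [seq x <- s | (x < p)%R] <= m)%N.
    by rewrite -ltnS; apply/(leq_trans _ sm)/(size_filter_lt (a := fun x => x < p) ps); rewrite ltxx.
  have szr : (size [seq x <- s | (p < x)%R] <= m)%N.
    by rewrite -ltnS; apply/(leq_trans _ sm)/(size_filter_lt (a := fun x => p < x) ps); rewrite ltxx.
  have fK (a : pred R) x : x \in [seq x <- s | a x] -> (kappa x < K)%N.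
    by rewrite mem_filter => /andP[_ /sK].
  have pK := sK _ ps.
  have TE : (\sum_(x <- s | x != p) same_class x p)%N = (class_size (kappa p) s).-1.
    rewrite /class_size -sum1_count [in RHS]big_mkcond [in RHS](bigD1_seq p)//= eqxx add1n/=.
    by apply: eq_bigr => x _; rewrite /same_class; case: eqP.
  rewrite TE; set T := _.-1; set sl := [seq x <- s | x < p]; set sr := [seq x <- s | p < x].
  (* The right subarray is averaged first, with the left cost [a] held fixed. The outcome is again a
     squared distance for [a], so the induction hypothesis applies to the left subarray. *)
  have step a : law same_class m sr (fun d => ((T + (a + d))%:R - b) ^+ 2) <=
      class_sum var_bound sr + (a%:R - (b - T%:R - class_sum mean_cost sr)) ^+ 2.
    have := IH sr (b - T%:R - a%:R) (filter_uniq _ us) (@fK _) szr.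
    have -> : (class_sum mean_cost sr - (b - T%:R - a%:R)) = (a%:R - (b - T%:R - class_sum mean_cost sr)) by ring.
    apply: le_trans; rewrite le_eqVlt; apply/orP; left; apply/eqP.
    by apply: eq_law => d; congr (_ ^+ 2); rewrite !natrD; ring.
  apply: (le_trans (law_le _ _ _ step)); rewrite lawD law_cst.
  have := IH sl (b - T%:R - class_sum mean_cost sr) (filter_uniq _ us) (@fK _) szl.
  rewrite -(lerD2l (class_sum var_bound sr)) => /le_trans; apply.
  have hu : var_bound 0 = 0 :> R by rewrite /var_bound mulr0 mul0r.
  have := class_sum_split hu us ps pK; have := class_sum_split mean_cost0 us ps pK.
  rewrite /= -/sl -/sr /H /delta -/T => e1 e2; rewrite addrA [_ + class_sum var_bound sl]addrC e2.
  have -> : class_sum mean_cost sl = class_sum mean_cost s - mean_cost (class_size (kappa p) s) +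
      mean_cost (class_rank s p) + mean_cost (T - class_rank s p) - class_sum mean_cost sr by rewrite -e1 addrK.
  by rewrite le_eqVlt; apply/orP; left; apply/eqP; ring.
rewrite sum_class_rank//.
(* Distributing the factor [size s] over the classes leaves one inequality per class. *)
have -> : (size s)%:R = \sum_(I < K) (class_size I s)%:R :> R.
  have := @sum_class_rank (fun _ _ => 1) s us sK; rewrite big_const_seq count_predT iter_addr_0.
  by move=> ->; apply: eq_bigr => I _; rewrite sumr_const card_ord.
rewrite mulr_suml; apply: ler_sum => I _; set a := class_size I s.
rewrite {}/H; set U := class_sum var_bound s; set M := class_sum mean_cost s.
rewrite (eq_bigr (fun j : 'I_a => (delta a j ^+ 2 + var_bound j + var_bound (a.-1 - j)) +
   ((U - var_bound a + (M - b) ^+ 2) + 2 * (M - b) * delta a j))); last by move=> j _; ring.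
have E c c' : \sum_(j < a) (c + c' * delta a j) = a%:R * c :> R.
  by rewrite big_split/= -mulr_sumr sum_delta mulr0 addr0 sumr_const card_ord mulr_natl.
rewrite big_split/= E.
by have := sum_sqr_delta_var_bound (R:=R) a; rewrite mulrDr mulrBr mulrDr; lra.
Qed.

End ClassCost.

(** * Independent uniform letters *)

Section UniformCells.
Context {R : realType}.
Implicit Types (c : seq nat) (Phi Psi : seq nat -> R) (g : nat -> R).

(* The mean of [Phi] over words of [n] independent uniform letters below [m]. *)
Fixpoint avg m n Phi : R :=
  if n is n'.+1 then avg m n' (fun c => m%:R^-1 * \sum_(x < m) Phi (rcons c x))
  else Phi [::].

Lemma eq_avg m n Phi Psi : Phi =1 Psi -> avg m n Phi = avg m n Psi.
Proof. by move=> /funext ->. Qed.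

Lemma avg_le m n Phi Psi :
  (forall c, size c = n -> all (fun x => x < m)%N c -> Phi c <= Psi c) ->
  avg m n Phi <= avg m n Psi.
Proof.
elim: n Phi Psi => [|n IH] Phi Psi h /=; first exact: h.
apply: IH => c sc mc; rewrite ler_wpM2l ?invr_ge0//; apply: ler_sum => x _.
by apply: h; rewrite ?size_rcons ?sc// all_rcons ltn_ord.
Qed.

Lemma avgD m n Phi Psi : avg m n (fun c => Phi c + Psi c) = avg m n Phi + avg m n Psi.
Proof.
elim: n Phi Psi => [|n IH] Phi Psi //=; rewrite -IH; apply: eq_avg => c.
by rewrite big_split/= mulrDr.
Qed.

Lemma avgZ m n Phi r : avg m n (fun c => r * Phi c) = r * avg m n Phi.
Proof.
elim: n Phi => [|n IH] Phi //=; rewrite -IH; apply: eq_avg => c.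
by rewrite -mulr_sumr mulrCA.
Qed.

Lemma avg_cst m n r : (0 < m)%N -> avg m n (fun=> r) = r.
Proof.
move=> m0; elim: n => [|n IH] //=; rewrite -[RHS]IH; apply: eq_avg => c.
by rewrite sumr_const card_ord -[r *+ _]mulr_natl mulKf// pnatr_eq0 -lt0n.
Qed.

Lemma avg_sum m n (I : Type) (r : seq I) (F : I -> seq nat -> R) : (0 < m)%N ->
  avg m n (fun c => \sum_(i <- r) F i c) = \sum_(i <- r) avg m n (F i).
Proof.
move=> m0; elim: r => [|i r IH].
  by rewrite big_nil -[RHS](avg_cst n 0 m0); apply: eq_avg => c; rewrite big_nil.
by rewrite big_cons -IH -avgD; apply: eq_avg => c; rewrite big_cons.
Qed.

(* [cell_sum (mean_step q g)] is the conditional mean of [cell_sum g] after one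
   more letter, each class having probability [q]. *)
Definition mean_step (q : R) g : nat -> R := fun a => g a + q * (g a.+1 - g a).

Section Classes.
Variables (m K : nat) (kappa : nat -> nat).
Hypothesis m_gt0 : (0 < m)%N.
Hypothesis K_gt0 : (0 < K)%N.
Hypothesis kappaK : forall x, (x < m)%N -> (kappa x < K)%N.
Hypothesis kappa_unif : forall h : nat -> R,
  m%:R^-1 * \sum_(x < m) h (kappa x) = K%:R^-1 * \sum_(I < K) h I.

Let q : R := K%:R^-1.

Definition cell_size I c := count (fun x => kappa x == I) c.

Definition cell_sum g c := \sum_(I < K) g (cell_size I c).

(** The iterate at 0 is the mean of [g] at a binomial variable with parameters n and [q], so this is
    the mean of [cell_sum g] over words of n letters. *)
Let mean_fun g n : R := K%:R * iter n (mean_step q) g 0%N.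

Let Kq : K%:R * q = 1. Proof. by rewrite mulfV// pnatr_eq0 -lt0n. Qed.

Let q_ge0 : 0 <= q. Proof. by rewrite invr_ge0. Qed.

Let q_le1 : q <= 1. Proof. by rewrite invf_le1 ?ltr0n// ler1n. Qed.

Let sum_cst (r : R) : \sum_(I < K) r = K%:R * r.
Proof. by rewrite sumr_const card_ord mulr_natl. Qed.

Lemma sum_cell_size c : all (fun x => x < m)%N c ->
  \sum_(I < K) (cell_size I c)%:R = (size c)%:R :> R.
Proof.
elim: c => [|x c IH]/=; first by move=> _; exact: big1.
move=> /andP[xm /IH cE]; rewrite (eq_bigr (fun I : 'I_K => (kappa x == I)%:R + (cell_size I c)%:R)).
  rewrite big_split/= cE (bigD1 (Ordinal (kappaK xm)))//= eqxx big1 ?addr0 ?nat1r//.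
  move=> I Ix; rewrite (_ : (kappa x == I) = false)//.
  by apply: contra_neqF Ix => /eqP xI; exact: val_inj.
by move=> I _; rewrite -natrD.
Qed.

Lemma cell_sum_rcons g c x : (x < m)%N ->
  cell_sum g (rcons c x) = cell_sum g c +
    (g (cell_size (kappa x) c).+1 - g (cell_size (kappa x) c)).
Proof.
move=> /kappaK xK; rewrite /cell_sum (bigD1 (Ordinal xK))//= [in RHS](bigD1 (Ordinal xK))//=.
have cE I : cell_size I (rcons c x) = (cell_size I c + (kappa x == I))%N.
  by rewrite /cell_size -cats1 count_cat/= addn0.
rewrite cE eqxx addn1 [X in _ + X](eq_bigr (fun I : 'I_K => g (cell_size I c))).
  ring.
move=> I Ix; rewrite cE (_ : (kappa x == I) = false) ?addn0//.
by apply: contra_neqF Ix => /eqP xI; exact: val_inj.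
Qed.

Lemma cell_sum_mean_step g c : cell_sum (mean_step q g) c =
  cell_sum g c + q * \sum_(I < K) (g (cell_size I c).+1 - g (cell_size I c)).
Proof. by rewrite /cell_sum big_split/= -mulr_sumr. Qed.

(** An increment of [mean_step q g] is the convex combination, with weights 1 - q and q, of two
    successive increments of [g]; the square is convex. *)
Lemma sqr_diff_mean_step g C D : (forall a, (g a.+1 - g a) ^+ 2 <= C * a%:R + D) ->
  forall a, (mean_step q g a.+1 - mean_step q g a) ^+ 2 <= C * a%:R + (D + C * q).
Proof.
move=> gC a; rewrite /mean_step; have h1 := gC a; have h2 := gC a.+1.
rewrite -[a.+1%:R]natr1 in h2; move: h1 h2 q_ge0 q_le1.
set x := g a.+1 - g a; set y := g a.+2 - g a.+1 => h1 h2 q0 q1.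
have -> : g a.+1 + q * y - (g a + q * x) = (1 - q) * x + q * y by rewrite /x; ring.
have h3 : 0 <= (1 - q) * q * (x - y) ^+ 2.
  by rewrite mulr_ge0 ?sqr_ge0// mulr_ge0// subr_ge0.
have h4 : q * y ^+ 2 <= q * (C * (a%:R + 1) + D) by rewrite ler_wpM2l.
have h5 : (1 - q) * x ^+ 2 <= (1 - q) * (C * a%:R + D) by rewrite ler_wpM2l// subr_ge0.
lra.
Qed.

Lemma sqr_diff_iter_mean_step g C D n : (forall a, (g a.+1 - g a) ^+ 2 <= C * a%:R + D) ->
  forall a, (iter n (mean_step q) g a.+1 - iter n (mean_step q) g a) ^+ 2
            <= C * a%:R + (D + n%:R * (C * q)).
Proof.
move=> gC; elim: n => [|n IH] a /=; first by rewrite mul0r addr0.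
by rewrite -[n.+1%:R]natr1 mulrDl mul1r [D + (_ + _)]addrA; exact: sqr_diff_mean_step.
Qed.

(** Since K q = 1, the increment in n equals the increment from 0 to 1 of the n-th iterate, where
    the term [C * a] vanishes. *)
Lemma sqr_diff_mean_fun g C n : (forall a, (g a.+1 - g a) ^+ 2 <= C * a%:R) ->
  (mean_fun g n.+1 - mean_fun g n) ^+ 2 <= C * q * n%:R.
Proof.
move=> gC; have gC0 a : (g a.+1 - g a) ^+ 2 <= C * a%:R + 0 by rewrite addr0.
have := sqr_diff_iter_mean_step n gC0 0; rewrite mulr0 !add0r => h.
rewrite /mean_fun iterS -mulrBr {1}/mean_step [_ + _ - _]addrAC subrr add0r mulrA Kq mul1r.
by rewrite (le_trans h)// mulrC.
Qed.

(* Revealing the letters one at a time, the increments of the resulting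
   martingale have conditional variance at most [C q n + D]. *)
Lemma avg_sqr_cell_sum g C D n b :
  (forall a, (g a.+1 - g a) ^+ 2 <= C * a%:R + D) ->
  avg m n (fun c => (cell_sum g c - b) ^+ 2) <=
  n%:R * (C * q * (n%:R - 1) + D) + (mean_fun g n - b) ^+ 2.
Proof.
elim: n g D => [|n IH] g D gC /=.
  by rewrite mul0r add0r /mean_fun/= /cell_sum/= sum_cst.
rewrite /mean_fun iterSr.
apply: (@le_trans _ _ (avg m n (fun c => (cell_sum (mean_step q g) c - b) ^+ 2 +
  (C * q * n%:R + D)))); last first.
  rewrite avgD avg_cst//; have := IH _ _ (sqr_diff_mean_step gC).
  rewrite -/(mean_fun _ _) -[n.+1%:R]natr1; set A := avg _ _ _; set B := (_ - b) ^+ 2; lra.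
apply: avg_le => c sc mc; pose d I := g (cell_size I c).+1 - g (cell_size I c).
rewrite (eq_bigr (fun x : 'I_m => (cell_sum g c + d (kappa x) - b) ^+ 2)); last first.
  by move=> x _; rewrite cell_sum_rcons.
rewrite (kappa_unif (fun I => (cell_sum g c + d I - b) ^+ 2)) cell_sum_mean_step -/q.
rewrite -[\sum_(I < K) (g _ - _)]/(\sum_(I < K) d I).
set G := cell_sum g c; set S := \sum_(I < K) d I.
have -> : \sum_(I < K) (G + d I - b) ^+ 2 =
    K%:R * (G - b) ^+ 2 + 2 * (G - b) * S + \sum_(I < K) d I ^+ 2.
  by rewrite -sum_cst mulr_sumr -!big_split/=; apply: eq_bigr => I _; ring.
have h : \sum_(I < K) d I ^+ 2 <= C * n%:R + K%:R * D.
  rewrite -sum_cst -sc -(sum_cell_size mc) mulr_sumr -big_split/=.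
  by apply: ler_sum => I _; exact: gC.
have h2 : q * \sum_(I < K) d I ^+ 2 <= q * (C * n%:R + K%:R * D) by rewrite ler_wpM2l.
(* The conditional variance of the increment is bounded by its second moment, so the squared
   conditional mean is dropped. *)
have h3 : 0 <= (q * S) ^+ 2 by exact: sqr_ge0.
have h4 : q * (K%:R * (G - b) ^+ 2) = (G - b) ^+ 2 by rewrite mulrA [q * _]mulrC Kq mul1r.
have h5 : q * (K%:R * D) = D by rewrite mulrA [q * _]mulrC Kq mul1r.
have -> : (G + q * S - b) ^+ 2 = (G - b) ^+ 2 + 2 * (G - b) * (q * S) + (q * S) ^+ 2 by ring.
lra.
Qed.

(** [var_bound] counts ordered pairs inside a class 75 times, and each of the n (n - 1) ordered
    pairs of letters shares its class with probability [q]. *)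
Lemma avg_cell_sum_var_bound n : avg m n (cell_sum var_bound) = 75 * q * n%:R * (n%:R - 1).
Proof.
elim: n => [|n IH] /=.
  by rewrite mulr0 mul0r /cell_sum; apply: big1 => I _; rewrite /var_bound mulr0 mul0r.
transitivity (avg m n (fun c => cell_sum var_bound c + 150 * q * n%:R)); last first.
  by rewrite avgD avg_cst// IH -[n.+1%:R]natr1; ring.
(* Two inequalities, because [avg_le] gives access to the length and the range of the letters, while
   [eq_avg] does not. *)
apply/eqP; rewrite eq_le; apply/andP; split; apply: avg_le => c sc mc.
all: rewrite (eq_bigr (fun x : 'I_m => cell_sum var_bound c + 150 * (cell_size (kappa x) c)%:R)); 
  last by move=> x _; rewrite cell_sum_rcons// /var_bound -natr1; congr (_ + _); ring.
all: rewrite (kappa_unif (fun I => cell_sum var_bound c + 150 * (cell_size I c)%:R)) big_split/= sum_cst.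
all: rewrite -mulr_sumr sum_cell_size// sc -/q mulrDr mulrA [q * K%:R]mulrC Kq mul1r; lra.
Qed.

End Classes.
End UniformCells.

(** * Poisson moments *)

Section PoissonMoments.
Context {R : realType}.

(** Cauchy-Schwarz over the increments between k and n, each of square at most G (n + k - 1). *)
Lemma sqr_diff_growth (F : nat -> R) (G : R) : 0 <= G ->
  (forall n, (F n.+1 - F n) ^+ 2 <= G * n%:R) ->
  forall n k, (F n - F k) ^+ 2 <= G * ((n%:R - k%:R) ^+ 2 * (n%:R + k%:R - 1)).
Proof.
move=> G0 FG.
have up k d : (F (k + d)%N - F k) ^+ 2 <= G * (d%:R ^+ 2 * (k%:R + d%:R - 1)).
  elim: d => [|d IH]; first by rewrite addn0 subrr expr0n/= mul0r mulr0.
  have := FG (k + d)%N; rewrite -addnS natrD.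
  case: d IH => [|d] IH.
    by rewrite addn1 !addr0 => h; rewrite expr1n mul1r addrK.
  move: IH; rewrite -[d.+2%:R]natr1; set e : R := d.+1%:R.
  have e0 : 0 < e by rewrite ltr0n.
  set x := F (k + d.+1)%N - F k; set y := F (k + d.+2)%N - F (k + d.+1)%N => hx hy.
  have -> : F (k + d.+2)%N - F k = x + y by rewrite /x /y; ring.
  rewrite -(ler_pM2l e0).
  (* This is e (x + y)^2 <= (e + 1) x^2 + e (e + 1) y^2, the weights being those of e old increments
     against one new one. *)
  have h1 : 0 <= (x - e * y) ^+ 2 by exact: sqr_ge0.
  have h2 : (e + 1) * x ^+ 2 <= (e + 1) * (G * (e ^+ 2 * (k%:R + e - 1))).
    by rewrite ler_wpM2l// addr_ge0// ltW.
  have h3 : e * (e + 1) * y ^+ 2 <= e * (e + 1) * (G * (k%:R + e)).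
    by rewrite ler_wpM2l// mulr_ge0// ?addr_ge0// ltW.
  have h4 : 0 <= G * e ^+ 2 * (e + 1) by rewrite !mulr_ge0// ?sqr_ge0// addr_ge0// ltW.
  apply: (@le_trans _ _ ((e + 1) * x ^+ 2 + e * (e + 1) * y ^+ 2)); first by lra.
  apply: (le_trans (lerD h2 h3)); rewrite -subr_ge0; apply: le_trans h4 _.
  by rewrite le_eqVlt; apply/orP; left; apply/eqP; ring.
move=> n k; have [kn|/ltnW nk] := leqP k n.
  have := up k (n - k)%N; rewrite subnKC// natrB// => /le_trans; apply.
  rewrite ler_wpM2l// ler_wpM2l ?sqr_ge0//.
  have : 0 <= k%:R :> R by []. lra.
have := up n (k - n)%N; rewrite subnKC// natrB// -sqrrN opprB => /le_trans; apply.
rewrite ler_wpM2l// -[leLHS]mulrC -[leRHS]mulrC -[in leRHS]sqrrN opprB ler_wpM2r ?sqr_ge0//.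
have : 0 <= n%:R :> R by []. lra.
Qed.

Variable lambda : R.
Hypothesis lambda_gt0 : 0 < lambda.

Local Notation pois := (poisson_pmf lambda).

(** The first r terms vanish, and (r + i)_r / (r + i)! = 1 / i! turns the others into the
    exponential series. Polynomials are therefore expanded in falling factorials below. *)
Lemma cvg_poisson_ffact r :
  series (fun n => (n ^_ r)%:R * pois n) @ \oo --> lambda ^+ r.
Proof.
rewrite -(cvg_shiftn r).
have e1 : lambda ^+ r * expR (- lambda) * expR lambda = lambda ^+ r.
  by rewrite -mulrA [expR _ * _]mulrC expRxMexpNx_1 mulr1.
suff -> : [sequence series (fun n => (n ^_ r)%:R * pois n) (n + r)%N]_n =
    (fun n => lambda ^+ r * expR (- lambda) * series (exp_coeff lambda) n).
  have : lambda ^+ r * expR (- lambda) * series (exp_coeff lambda) n @[n --> \oo] -->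
      lambda ^+ r * expR (- lambda) * expR lambda.
    by apply: cvgMl_tmp; exact: is_cvg_series_exp_coeff.
  by rewrite e1.
apply/funext => n; rewrite /series/= /index_iota !subn0 addnC iotaD big_cat/=.
rewrite big1_seq ?add0r; last first.
  by move=> i /andP[_]; rewrite mem_iota add0n => /andP[_ ir]; rewrite ffact_small// mul0r.
rewrite add0n -[X in iota X](addn0 r) iotaDl big_map mulr_sumr; apply: eq_bigr => i _.
rewrite /poisson_pmf lambda_gt0 /exp_coeff/=.
have fE : (r + i)`!%:R = ((r + i) ^_ r)%:R * i`!%:R :> R.
  by rewrite -natrM -(@ffact_fact (r + i) r) ?leq_addr// addKn.
have f0 : ((r + i) ^_ r)%:R != 0 :> R by rewrite pnatr_eq0 -lt0n ffact_gt0 leq_addr.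
have i0 : i`!%:R != 0 :> R by rewrite pnatr_eq0 -lt0n fact_gt0.
by rewrite fE exprD; field; rewrite i0 f0.
Qed.

Lemma nneseries_poisson_cubic (a : nat -> R) (f : nat -> R) : (forall n, 0 <= f n) ->
  (forall n, f n = \sum_(r < 4) a r * (n ^_ r)%:R) ->
  (\sum_(n <oo) (pois n * f n)%:E = (\sum_(r < 4) a r * lambda ^+ r)%:E)%E.
Proof.
move=> f0 fE.
have h : series (fun n => pois n * f n) @ \oo --> \sum_(r < 4) a r * lambda ^+ r.
  rewrite [X in X @ _ --> _](_ : _ = (fun n => \sum_(r < 4) a r *
      series (fun n => (n ^_ r)%:R * pois n) n)).
    apply: cvg_big => [|r _]; first exact: add_continuous.
    by apply: cvgMl_tmp; exact: cvg_poisson_ffact.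
  apply/funext => n; rewrite /series/=; under [RHS]eq_bigr do rewrite mulr_sumr.
  rewrite exchange_big/=; apply: eq_bigr => i _; rewrite fE mulr_sumr.
  by apply: eq_bigr => r _; ring.
apply/cvg_lim => //; rewrite (_ : (fun n => _) = EFin \o series (fun n => pois n * f n)).
  exact: cvg_comp h _.
by apply/funext => n; rewrite /= /series/= sumEFin.
Qed.

Lemma ffactr2 n : (n ^_ 2)%:R = n%:R * (n%:R - 1) :> R.
Proof.
case: n => [|n]; first by rewrite mul0r.
by rewrite ffactnS ffactn1 natrM/= -[n.+1%:R]natr1 addrK.
Qed.

Lemma ffactr3 n : (n ^_ 3)%:R = n%:R * (n%:R - 1) * (n%:R - 2) :> R.
Proof.
case: n => [|n]; first by rewrite !mul0r.
by rewrite ffactnS natrM ffactr2/= -[n.+1%:R]natr1; ring.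
Qed.

(** 87 collects 75 from the pivots and 12 from the keys. The case lambda < 1 is separate because
    there only falling factorials of order at least 2 may appear in the majorant. *)
Lemma poisson_sqr_dev (F : nat -> R) (q : R) : 0 <= q ->
  (forall n, (F n.+1 - F n) ^+ 2 <= 12 * q * n%:R) ->
  (\sum_(n <oo) (pois n * (87 * q * (n%:R * (n%:R - 1)) +
      (F n - F (Num.truncn lambda)) ^+ 2))%:E <= (207 * q * lambda ^+ 2)%:E)%E.
Proof.
move=> q0 FG; have q12 : 0 <= 12 * q by rewrite mulr_ge0.
set k := Num.truncn lambda.
have grow n : (F n - F k) ^+ 2 <= 12 * q * ((n%:R - k%:R) ^+ 2 * (n%:R + k%:R - 1)).
  exact: sqr_diff_growth.
suff [a aE [fa]] : exists2 a : nat -> R, (forall n : nat,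
      87 * q * (n%:R * (n%:R - 1)) + 12 * q * ((n%:R - k%:R) ^+ 2 * (n%:R + k%:R - 1)) <=
      \sum_(r < 4) a r * (n ^_ r)%:R) &
    \sum_(r < 4) a r * lambda ^+ r <= 207 * q * lambda ^+ 2.
  have n2 n : 0 <= n%:R * (n%:R - 1) :> R by rewrite -ffactr2.
  have f0 n : 0 <= 87 * q * (n%:R * (n%:R - 1)) + (F n - F k) ^+ 2.
    by rewrite addr_ge0 ?sqr_ge0// mulr_ge0// mulr_ge0.
  have fle n : 87 * q * (n%:R * (n%:R - 1)) + (F n - F k) ^+ 2 <=
      \sum_(r < 4) a r * (n ^_ r)%:R.
    by apply: le_trans (aE n); rewrite lerD2l.
  apply: (@le_trans _ _ (\sum_(n <oo) (pois n * \sum_(r < 4) a r * (n ^_ r)%:R)%:E)%E).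
    apply: lee_nneseries => n _ *; rewrite lee_fin; first by rewrite mulr_ge0 ?poisson_pmf_ge0.
    by rewrite ler_wpM2l ?poisson_pmf_ge0.
  rewrite (nneseries_poisson_cubic (a := a))// ?lee_fin// => n.
  exact: le_trans (f0 n) (fle n).
have [l1|l1] := ltP lambda 1.
  have k0 : k = 0%N by apply/eqP; rewrite -leqn0 -ltnS truncn_lt_nat// ltW.
  (* From n^2 (n - 1) = (n)_3 + 2 (n)_2, and 111 = 87 + 24. *)
  exists (fun r => nth 0 [:: 0; 0; 111 * q; 12 * q] r).
    move=> n; rewrite !big_ord_recr big_ord0/= k0 ffactr2 ffactr3 ffactn1.
    by rewrite le_eqVlt; apply/orP; left; apply/eqP; ring.
  rewrite !big_ord_recr big_ord0/= !mul0r !add0r.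
  have : 0 <= q * lambda ^+ 2 * (1 - lambda).
    by apply: mulr_ge0; [apply: mulr_ge0 => //; exact: sqr_ge0 | rewrite subr_ge0 ltW].
  have : 0 <= q * lambda ^+ 2 by rewrite mulr_ge0// sqr_ge0.
  lra.
have kle : k%:R <= lambda by rewrite truncn_le ltW.
have klt : lambda < k%:R + 1 by rewrite natr1 truncnS_gt.
(* These are the coefficients of 87 q (n)_2 + 24 q ((n - lambda)^2 + 1) (n + lambda). In the Poisson
   mean the cubes cancel and leave 87 q lambda^2 + 24 q (2 lambda^2 + 3 lambda), at most 207 q
   lambda^2 because lambda >= 1. *)
exists (fun r => nth 0 [:: 24 * q * (lambda ^+ 3 + lambda);
    24 * q * (2 - lambda - lambda ^+ 2); 87 * q + 24 * q * (3 - lambda); 24 * q] r).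
  move=> n; rewrite !big_ord_recr big_ord0/= ffactr2 ffactr3 ffactn1 ffactn0.
  have h : (n%:R - k%:R) ^+ 2 * (n%:R + k%:R - 1) <=
      (2 * (n%:R - lambda) ^+ 2 + 2) * (n%:R + lambda).
    apply: (@le_trans _ _ ((n%:R - k%:R) ^+ 2 * (n%:R + lambda))).
      by rewrite ler_wpM2l ?sqr_ge0//; lra.
    apply: ler_wpM2r; first by rewrite addr_ge0// ltW.
    have : (lambda - k%:R) ^+ 2 <= 1 by rewrite expr_le1//; lra.
    have : 0 <= (n%:R - lambda - (lambda - k%:R)) ^+ 2 by exact: sqr_ge0.
    lra.
  have := ler_wpM2l q12 h; lra.
rewrite !big_ord_recr big_ord0/=.
have : 0 <= q * lambda * (lambda - 1).
  by rewrite !mulr_ge0// ?subr_ge0// ltW.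
lra.
Qed.

End PoissonMoments.

(** * Discrete events and independent pivots *)

Section DiscreteEvents.
Context {d : measure_display} {T : measurableType d} {R : realType}.
Variable P : probability T R.

Definition pr (A : set T) : R := fine (P A).

Lemma prE A : measurable A -> P A = (pr A)%:E.
Proof. by move=> mA; rewrite fineK// fin_num_measure. Qed.

Lemma pr_ge0 A : 0 <= pr A. Proof. exact: fine_ge0. Qed.

Lemma pr_setT : pr setT = 1. Proof. by rewrite /pr probability_setT. Qed.

Lemma pr_set0 : pr set0 = 0. Proof. by rewrite /pr measure0. Qed.

Lemma prU A B : measurable A -> measurable B -> A `&` B = set0 -> pr (A `|` B) = pr A + pr B.
Proof. by move=> mA mB AB; rewrite /pr measureU// fineD// fin_num_measure. Qed.

Lemma le_pr A B : measurable A -> measurable B -> A `<=` B -> pr A <= pr B.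
Proof.
by move=> mA mB AB; rewrite fine_le ?fin_num_measure// le_measure// inE.
Qed.

(** Measurability for the discrete sigma-algebra on the target: it is preserved by every map and
    makes sense for lists and functions of them. *)
Definition disc (Z : Type) (V : T -> Z) := forall B : set Z, measurable (V @^-1` B).

Lemma disc_comp (Y Z : Type) (g : Y -> Z) (V : T -> Y) : disc V -> disc (g \o V).
Proof. by move=> dV B; exact: dV (g @^-1` B). Qed.

Lemma disc_cst (Z : Type) (z : Z) : disc (cst z).
Proof. by move=> B; rewrite preimage_cst; case: ifP. Qed.

(** A random parameter with countably many values may be substituted into a family of discrete
    variables; this is how pivots and rounded keys enter the recursive cost. *)
Lemma disc_dep (Y : countType) (Z : Type) (V : T -> Y) (H : Y -> T -> Z) :
  disc V -> (forall y, disc (H y)) -> disc (fun t => H (V t) t).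
Proof.
move=> dV dH B.
rewrite [X in measurable X](_ : _ = \bigcup_n
    (if unpickle n is Some y then (V @^-1` [set y]) `&` (H y @^-1` B) else set0)).
  apply: bigcupT_measurable => n; case: unpickle => // y.
  by apply: measurableI; [exact: dV|exact: dH].
apply/seteqP; split => t /=.
  by move=> Bt; exists (pickle (V t)) => //; rewrite pickleK.
by move=> [n _]; case: unpickle => // y [/= <-].
Qed.

Lemma disc_points (Y : countType) (V : T -> Y) :
  (forall y, measurable (V @^-1` [set y])) -> disc V.
Proof.
move=> mV B; rewrite [X in measurable X](_ : _ = \bigcup_n
    (if unpickle n is Some y then (if `[< B y >] then V @^-1` [set y] else set0) else set0)).
  by apply: bigcupT_measurable => n; case: unpickle => // y; case: ifP.
apply/seteqP; split => t /=.
  by move=> Bt; exists (pickle (V t)) => //; rewrite pickleK ifT//; exact/asboolP.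
by move=> [n _]; case: unpickle => // y; case: asboolP => //= By ->.
Qed.

Lemma disc_event (V : T -> bool) : disc V -> measurable [set t | V t].
Proof. by move=> /(_ [set true]). Qed.

Lemma disc_RV (V : {RV P >-> nat}) : disc V.
Proof. by move=> B; rewrite -[X in measurable X]setTI; exact: measurable_funP. Qed.

Lemma pr_lt (V : T -> nat) n A : disc V -> measurable A ->
  pr (A `&` [set t | (V t < n)%N]) = \sum_(i < n) pr (A `&` [set t | V t == i]).
Proof.
move=> dV mA; have mE (p : pred nat) : measurable (A `&` [set t | p (V t)]).
  by apply: measurableI => //; apply: disc_event; exact: disc_comp dV.
elim: n => [|n IH].
  by rewrite big_ord0 (_ : _ `&` _ = set0) ?pr_set0//; apply/seteqP; split => t // [].
rewrite big_ord_recr/= -IH -prU; [|exact: (mE (fun x => x < n)%N)|exact: (mE (fun x => x == n))|].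
  congr pr; rewrite -setIUr; congr (_ `&` _); apply/funext => t; apply/propext => /=.
  by rewrite ltnS leq_eqVlt; split=> [/orP[]|[]->]; rewrite ?orbT//; [right|left].
by apply/seteqP; split => t //= -[[_ h] [_ /eqP e]]; rewrite e ltnn in h.
Qed.

(** Total probability for a variable that is below n only almost surely, which is all that is known
    of pivot positions and of cells. *)
Lemma pr_split (V : T -> nat) n A : disc V -> measurable A ->
  \sum_(i < n) pr [set t | V t == i] = 1 ->
  pr A = \sum_(i < n) pr (A `&` [set t | V t == i]).
Proof.
move=> dV mA V1; have mV : measurable [set t | (V t < n)%N].
  by apply: disc_event; exact: (disc_comp (fun x => (x < n)%N)).
have {}V1 : pr [set t | (V t < n)%N] = 1.
  rewrite -[X in pr X]setTI pr_lt// -V1; apply: eq_bigr => i _; by rewrite setTI.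
rewrite -pr_lt//.
have V0 : pr (~` [set t | (V t < n)%N]) = 0.
  apply: (@addrI _ (pr [set t | (V t < n)%N])).
  by rewrite -prU ?setICr// ?setUv ?pr_setT ?addr0//; exact: measurableC.
rewrite {1}(_ : A = (A `&` [set t | (V t < n)%N]) `|` (A `&` ~` [set t | (V t < n)%N])); last first.
  by rewrite -setIUr setUv setIT.
rewrite prU.
- rewrite [X in _ + X](_ : _ = 0) ?addr0//; apply/eqP.
  rewrite eq_le pr_ge0 andbT -V0 le_pr//; last exact: measurableC.
  by apply: measurableI => //; exact: measurableC.
- exact: measurableI.
- by apply: measurableI => //; exact: measurableC.
- by rewrite setIACA setICr setI0.
Qed.

Lemma pr_split_bounded (V : T -> nat) n A : disc V -> measurable A ->
  A `<=` [set t | (V t < n)%N] ->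
  pr A = \sum_(i < n) pr (A `&` [set t | V t == i]).
Proof. by move=> dV mA AV; rewrite -pr_lt// setIidl. Qed.

End DiscreteEvents.

(** * From independent pivots to [law] *)

Section RandomPivots.
Context {d : measure_display} {T : measurableType d} {R : realType}.
Variables (P : probability T R) (J : seq bool -> nat -> {RV P >-> nat}).
Local Notation pr := (pr P).

Hypothesis J_unif : forall w n, (2 <= n)%N ->
  forall i, (i < n)%N -> pr [set t | J w n t == i] = n%:R^-1.

Definition pivots_at u (ls : seq (seq bool * nat)) (e : seq bool * nat -> nat) : set T :=
  [set t | all (fun i => J (u ++ i.1) i.2 t == e i) ls].

(* [A] is independent of the pivot choices in the subtree of calls below [u]. *)
Definition indep_below u A := measurable A /\
  forall ls e, uniq ls -> pr (A `&` pivots_at u ls e) =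
    pr A * \prod_(i <- ls) pr [set t | J (u ++ i.1) i.2 t == e i].

Definition pivots u (t : T) : seq bool -> nat -> nat := fun w n => J (u ++ w) n t.

Lemma pivots_rcons u b t : (fun w => pivots u t (b :: w)) = pivots (rcons u b) t.
Proof. by apply/funext => w; apply/funext => n; rewrite /pivots cat_rcons. Qed.

Lemma measurable_pivots_at u ls e : measurable (pivots_at u ls e).
Proof.
apply: disc_event; elim: ls => [|i ls IH]/=; first exact: (disc_cst true).
apply: (@disc_dep _ _ bool _ _ (fun b t => b && all _ ls)).
  by apply: (disc_comp (fun x => x == e i)); exact: disc_RV.
by move=> b; exact: disc_comp IH.
Qed.

Lemma disc_total_cost f m u (s : seq R) : disc (fun t => total_cost f m (pivots u t) s).
Proof.
elim: m u s => [|m IH] u s.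
  by rewrite [X in disc X](_ : _ = cst 0%N); [exact: disc_cst|by apply/funext => t; rewrite /total_cost big_nil].
have [s1|s1] := leqP (size s) 1.
  rewrite [X in disc X](_ : _ = cst 0%N); first exact: disc_cst.
  by apply/funext => t; rewrite total_cost_small.
pose H i t := let p := nth (head 0 s) s i in
  (\sum_(x <- s | x != p) f x p + (total_cost f m (pivots (rcons u false) t) [seq x <- s | (x < p)%R]
   + total_cost f m (pivots (rcons u true) t) [seq x <- s | (p < x)%R]))%N.
rewrite [X in disc X](_ : _ = fun t => H (J u (size s) t) t); last first.
  by apply/funext => t; rewrite total_costS// !pivots_rcons /pivots cats0.
apply: (disc_dep (H := H)); first exact: disc_RV.
move=> i; rewrite /H /=; apply: (disc_comp (fun x => (_ + x)%N)).
apply: (disc_dep (H := fun a t => (a + total_cost f m _ _)%N)); first exact: IH.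
by move=> a; apply: (disc_comp (fun x => (a + x)%N)); exact: IH.
Qed.

Lemma measurable_total_cost f m u (s : seq R) (phi : pred nat) :
  measurable [set t | phi (total_cost f m (pivots u t) s)].
Proof.
by apply: disc_event; apply: (disc_comp (phi)); exact: disc_total_cost.
Qed.

(** The pivot at [u] and those below one child have other addresses than those below the other
    child, so prescribing them preserves independence from the latter. *)
Lemma indep_child u A b n i ls e : indep_below u A -> uniq ls ->
  let E := A `&` [set t | J u n t == i] `&` pivots_at (rcons u (~~ b)) ls e in
  indep_below (rcons u b) E /\
  pr E = pr A * pr [set t | J u n t == i] *
         \prod_(j <- ls) pr [set t | J (rcons u (~~ b) ++ j.1) j.2 t == e j].
Proof.
move=> [mA iA] uls E.
have mE : measurable E.
  apply: measurableI; last exact: measurable_pivots_at.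
  by apply: measurableI => //; apply: disc_event; apply: (disc_comp (fun x => x == i)); exact: disc_RV.
have key ls1 e1 : uniq ls1 -> pr (E `&` pivots_at (rcons u b) ls1 e1) =
    pr A * pr [set t | J u n t == i] *
    \prod_(j <- ls) pr [set t | J (rcons u (~~ b) ++ j.1) j.2 t == e j] *
    \prod_(j <- ls1) pr [set t | J (rcons u b ++ j.1) j.2 t == e1 j].
  move=> uls1; pose ext c (j : seq bool * nat) := (c :: j.1, j.2).
  have ext_inj c : injective (ext c) by move=> [w k] [w' k'] [-> ->].
  (* Addresses relative to [u]: the call itself, then calls below the child [~~ b], then calls below
     the child [b]. [e'] reads the prescribed value off the first step of the path. *)
  pose L := ([::], n) :: map (ext (~~ b)) ls ++ map (ext b) ls1.
  pose e' (j : seq bool * nat) := if j.1 is c :: w then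
     (if c == b then e1 (w, j.2) else e (w, j.2)) else i.
  have uL : uniq L.
    rewrite /= mem_cat cat_uniq !map_inj_uniq// uls uls1 andbT/=; apply/andP; split.
      by apply/negP => /orP[]/mapP[j _].
    by apply/hasPn => _ /mapP[j _ ->]; apply/negP => /mapP[k _ []]; case: (b).
  have -> : E `&` pivots_at (rcons u b) ls1 e1 = A `&` pivots_at u L e'.
    rewrite /E -!setIA; congr (_ `&` _); apply/funext => t; apply/propext.
    rewrite /pivots_at /= all_cat !all_map cats0 /=.
    have -> : all (preim (ext (~~ b)) (fun j => J (u ++ j.1) j.2 t == e' j)) ls =
        all (fun j => J (rcons u (~~ b) ++ j.1) j.2 t == e j) ls.
      apply: eq_all => -[w k] /=; rewrite cat_rcons /e'/=.
      by case: (b).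
    have -> : all (preim (ext b) (fun j => J (u ++ j.1) j.2 t == e' j)) ls1 =
        all (fun j => J (rcons u b ++ j.1) j.2 t == e1 j) ls1.
      by apply: eq_all => -[w k] /=; rewrite cat_rcons /e'/= eqxx.
    by split=> [[-> [-> ->]]//|/andP[-> /andP[-> ->]]].
  rewrite iA// big_cons/= cats0 -!mulrA; congr (_ * (_ * _)).
  rewrite big_cat/= !big_map/=; congr (_ * _); apply: eq_bigr => -[w k] _ /=.
    by rewrite cat_rcons /e'/=; case: (b).
  by rewrite cat_rcons /e'/= eqxx.
have prEE : pr E = pr A * pr [set t | J u n t == i] *
    \prod_(j <- ls) pr [set t | J (rcons u (~~ b) ++ j.1) j.2 t == e j].
  have := key [::] (fun=> 0%N) isT; rewrite big_nil mulr1 => <-; congr pr.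
  by rewrite /pivots_at/= [X in _ `&` X](_ : _ = setT) ?setIT//; apply/seteqP; split.
by split=> //; split=> // ls1 e1 u1; rewrite key// prEE.
Qed.

(** Carrying an arbitrary event [A] through the induction is what yields independence of the two
    recursive costs. *)
Lemma pr_total_cost f m u A (s : seq R) (phi : pred nat) : (forall x y, f x y <= 1)%N ->
  indep_below u A -> (size s <= m)%N ->
  pr (A `&` [set t | phi (total_cost f m (pivots u t) s)]) =
  pr A * law f m s (fun x => (phi x)%:R).
Proof.
move=> f1; have small m' u' A' (s' : seq R) (phi' : pred nat) : (size s' <= 1)%N ->
    pr (A' `&` [set t | phi' (total_cost f m' (pivots u' t) s')]) =
    pr A' * law f m' s' (fun x => (phi' x)%:R).
  move=> s1; rewrite law_small//; case: (boolP (phi' 0%N)) => h.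
    rewrite mulr1; congr pr; apply/seteqP; split=> t /= => [[]//|At].
    by rewrite total_cost_small.
  rewrite mulr0 -(pr_set0 P); congr pr; apply/seteqP; split=> t //= [_].
  by rewrite total_cost_small// (negbTE h).
elim: m u A s phi => [|m IH] u A s phi iA sm; first by apply: small; apply: leq_trans sm _.
have [s1|s1] := leqP (size s) 1; first exact: small.
have mA : measurable A := iA.1.
rewrite (pr_split (V := J u (size s)) (n := size s)); first last.
- under eq_bigr => i _ do rewrite (J_unif u s1 (ltn_ord i)).
  by rewrite sumr_const card_ord -[_^-1 *+ _]mulr_natl mulfV// pnatr_eq0 -lt0n ltnW.
- by apply: measurableI => //; exact: measurable_total_cost.
- exact: disc_RV.
rewrite /= leqNgt s1/= mulrCA mulr_sumr; rewrite mulr_sumr; apply: eq_bigr => i _.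
set p := nth _ _ _; set Tp := (\sum_(_ <- _ | _) _)%N.
have ps : p \in s by exact: pivot_mem.
set sl := [seq x <- s | x < p]; set sr := [seq x <- s | p < x].
have szl : (size sl <= m)%N.
  by rewrite -ltnS; apply/(leq_trans _ sm)/(size_filter_lt (a := fun x => x < p) ps); rewrite ltxx.
have szr : (size sr <= m)%N.
  by rewrite -ltnS; apply/(leq_trans _ sm)/(size_filter_lt (a := fun x => p < x) ps); rewrite ltxx.
pose E := A `&` [set t | J u (size s) t == i].
have nilT v : pivots_at v [::] (fun=> 0%N) = setT by apply/seteqP; split.
have [iE prEE] := indep_child true (size s) i (fun=> 0%N) iA (isT : uniq [::]).
rewrite nilT setIT -/E big_nil mulr1 (J_unif u s1 (ltn_ord i)) in iE prEE.
have mE := iE.1.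
pose D0 t := total_cost f m (pivots (rcons u false) t) sl.
pose D1 t := total_cost f m (pivots (rcons u true) t) sr.
(* The right cost is independent of the left pivots: these are first prescribed as part of the
   event, and the induction hypothesis for the right subarray is used under it. *)
have indE (psi : pred nat) : indep_below (rcons u false) (E `&` [set t | psi (D1 t)]).
  split; first by apply: measurableI => //; exact: (measurable_total_cost f m _ sr psi).
  move=> ls e uls; have [iE' prE'] := indep_child true (size s) i e iA uls.
  rewrite /= -/E in iE' prE'.
  rewrite -setIA [X in _ `&` X]setIC setIA (IH _ _ sr psi iE' szr) prE' (IH _ _ sr psi iE szr) prEE.
  by rewrite (J_unif u s1 (ltn_ord i)) mulrAC.
have -> : A `&` [set t | phi (total_cost f m.+1 (pivots u t) s)] `&` [set t | J u (size s) t == i] =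
    E `&` [set t | phi (Tp + (D0 t + D1 t))%N].
  have cE t : J u (size s) t == i -> total_cost f m.+1 (pivots u t) s = (Tp + (D0 t + D1 t))%N.
    move=> /eqP ji; rewrite total_costS//= !pivots_rcons.
    by rewrite (_ : pivots u t [::] (size s) = i)// /pivots cats0.
  rewrite /E -!setIA; congr (_ `&` _); apply/seteqP; split=> t /=.
    by move=> [h ji]; rewrite -cE.
  by move=> [ji h]; rewrite cE.
(* Splitting over the value of the left cost turns the condition on the sum into a condition on the
   right cost alone. *)
rewrite (@pr_split_bounded _ _ _ P D0 (size sl ^ 2).+1); first last.
- by move=> t _ /=; rewrite ltnS; exact: total_cost_le.
- apply: measurableI => //; apply: disc_event; apply: (disc_comp (phi)).
  apply: (disc_comp (fun x => (Tp + x)%N)).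
  apply: (disc_dep (H := fun a t => (a + D1 t)%N)); first exact: disc_total_cost.
  by move=> a; apply: (disc_comp (fun x => (a + x)%N)); exact: disc_total_cost.
- exact: disc_total_cost.
rewrite [X in _ = _ * (_ * X)](@law_expand _ _ _ _ _ (size sl ^ 2).+1)//.
rewrite !mulr_sumr; apply: eq_bigr => a _.
have -> : E `&` [set t | phi (Tp + (D0 t + D1 t))%N] `&` [set t | D0 t == a] =
    (E `&` [set t | phi (Tp + (a + D1 t))%N]) `&` [set t | D0 t == a].
  apply/seteqP; split=> t /= [[Et h] /eqP e]; (split; last exact/eqP); split=> //.
    by rewrite -e.
  by rewrite e.
rewrite (IH _ _ sl (fun x => x == a) (indE (fun x => phi (Tp + (a + x))%N)) szl).
rewrite (IH _ _ sr (fun x => phi (Tp + (a + x))%N) iE szr) prEE.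
ring.
Qed.

End RandomPivots.

(** * Dyadic cells *)

Section Cells.
Context {R : realType}.

(** For 0 <= x < 1 this is the number written by the first L bits of x. Negative x fall into cell
    0. *)
Definition cell L (x : R) : nat := Num.truncn (2 ^+ L * x).

Lemma cell_preimage L c : cell L @^-1` [set c] =
  (if c is 0 then `]-oo, (2 ^+ L)^-1[ else `[c%:R / 2 ^+ L, c.+1%:R / 2 ^+ L[)%classic :> set R.
Proof.
have L0 : 0 < 2 ^+ L :> R by rewrite exprn_gt0.
apply/seteqP; split=> x; rewrite /cell/=.
  move=> h; case: c h => [|c] h; rewrite /= in_itv/=.
    by rewrite -(ltr_pM2l L0) mulfV ?gt_eqF//; have := truncnS_gt (2 ^+ L * x); rewrite h.
  have x0 : 0 <= 2 ^+ L * x.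
    by rewrite (@le_trans _ _ 1)// -truncn_gt0 h.
  by rewrite ler_pdivrMr// ltr_pdivlMr// mulrC -truncn_eq// h.
case: c => [|c]; rewrite /= in_itv/=.
  by rewrite -(ltr_pM2l L0) mulfV ?gt_eqF// => h; apply/eqP; rewrite -leqn0 truncn_le_nat.
rewrite ler_pdivrMr// ltr_pdivlMr// [x * _]mulrC => h; apply/eqP.
by rewrite truncn_eq//; case/andP: h => h _; apply: le_trans h.
Qed.

Lemma measurable_cell L c : measurable (cell L @^-1` [set c]).
Proof. by rewrite cell_preimage; case: c => [|c]; exact: measurable_itv. Qed.

Lemma uniform_cell L c : (c < 2 ^ L)%N ->
  uniform_prob (@ltr01 R) (cell L @^-1` [set c]) = ((2 ^ L)%:R^-1)%:E.
Proof.
move=> cL; have L0 : 0 < 2 ^+ L :> R by rewrite exprn_gt0.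
rewrite /uniform_prob integral_uniform_pdf cell_preimage.
rewrite (_ : _ `&` _ = `[c%:R / 2 ^+ L, c.+1%:R / 2 ^+ L[%classic); last first.
  have c1 : c.+1%:R / 2 ^+ L <= 1 :> R by rewrite ler_pdivrMr// mul1r -natrX ler_nat.
  have c0 : 0 <= c%:R / 2 ^+ L :> R by rewrite divr_ge0// ltW.
  apply/seteqP; split=> x; case: c cL c0 c1 => [|c] cL c0 c1; rewrite /= !in_itv/= ?mul0r ?mul1r.
  - by move=> [-> /andP[-> _]].
  - by move=> [-> _].
  - by move=> /andP[h1 h2]; rewrite h2 h1/= ltW// (lt_le_trans h2)// -[_^-1]mul1r.
  - move=> /andP[h1 h2]; rewrite h1 h2 (le_trans c0 h1)/=; split=> //.
    by rewrite ltW// (lt_le_trans h2).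
rewrite (eq_integral (fun=> 1%:E)); last first.
  move=> x; rewrite inE/= in_itv/= /uniform_pdf => /andP[h1 h2].
  rewrite subr0 invr1 (le_trans _ h1) ?divr_ge0// ?(ltW L0)//=.
  by rewrite ifT// ltW// (lt_le_trans h2)// ler_pdivrMr// mul1r -natrX ler_nat.
rewrite integral_cst//= mul1e lebesgue_measure_itv/= lte_fin ltr_pM2r ?invr_gt0// ltr_nat ltnSn.
by rewrite -EFinB -mulrBl -[c.+1%:R]natr1 addrAC subrr add0r mul1r natrX.
Qed.

Lemma cell_half L x : (cell L.+1 x)./2 = cell L x.
Proof.
rewrite /cell exprS -mulrA; set y := 2 ^+ L * x.
have [y0|y0] := leP 0 y; last first.
  have n0 (z : R) : z < 0 -> Num.truncn z = 0%N :> nat.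
    by move=> z0; apply/eqP; rewrite -leqn0 truncn_le_nat (lt_le_trans z0).
  have y2 : 2 * y < 0 by rewrite pmulr_rlt0.
  by rewrite (n0 _ y2) (n0 _ y0).
apply/esym/eqP; rewrite truncn_eq//; set z := Num.truncn (2 * y).
have /andP[h1 h2] : z%:R <= 2 * y < z.+1%:R by apply: truncn_itv; rewrite mulr_ge0.
have := odd_double_half z; set w := z./2 => zE.
have zR : z%:R = (odd z)%:R + 2 * w%:R :> R by rewrite -[in LHS]zE natrD -muln2 natrM [w%:R * _]mulrC.
move: h1 h2; rewrite -!natr1 zR; case: (odd z) => /= h1 h2; apply/andP; split; lra.
Qed.

(** All coarser levels are read off the cell of level L, so one rounding of the keys serves all B_k
    with k <= L. *)
Lemma cell_divn L k x : (k <= L)%N -> cell k x = (cell L x %/ 2 ^ (L - k))%N.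
Proof.
move=> /subnK <-; rewrite addnK; elim: (L - k)%N => [|j IH]; first by rewrite add0n expn0 divn1.
by rewrite addSn IH -(cell_half (j + k)) -divn2 -divnMA expnS.
Qed.

Lemma sum_divn_blocks (h : nat -> R) M K : (0 < M)%N ->
  \sum_(x < K * M) h (x %/ M)%N = M%:R * \sum_(I < K) h I.
Proof.
move=> M0; elim: K => [|K IH]; first by rewrite mul0n !big_ord0 mulr0.
rewrite mulSn addnC -(big_mkord xpredT (fun x => h (x %/ M)%N)).
rewrite (big_cat_nat (n := (K * M)%N))//= ?leq_addr// big_mkord IH big_ord_recr/= mulrDr.
congr (_ + _); rewrite -[X in \sum_(X <= _ < _) _]add0n big_addn addKn.
rewrite big_mkord (eq_bigr (fun=> h K)) ?sumr_const ?card_ord ?mulr_natl// => i _.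
by rewrite addnC divnMDl// divn_small// addn0.
Qed.

Lemma block_unif L k (h : nat -> R) : (k <= L)%N ->
  (2 ^ L)%:R^-1 * \sum_(x < 2 ^ L) h (x %/ 2 ^ (L - k))%N =
  (2 ^ k)%:R^-1 * \sum_(I < 2 ^ k) h I.
Proof.
move=> kL; have -> : (2 ^ L = 2 ^ k * 2 ^ (L - k))%N by rewrite -expnD subnKC.
rewrite sum_divn_blocks ?expn_gt0// natrM mulrA; congr (_ * _).
have a0 : (2 ^ k)%:R != 0 :> R by rewrite pnatr_eq0 -lt0n expn_gt0.
have b0 : (2 ^ (L - k))%:R != 0 :> R by rewrite pnatr_eq0 -lt0n expn_gt0.
by field; rewrite a0 b0.
Qed.

(* Distinct keys lying in prescribed cells: ties are broken by the index. *)
Definition keys (c : seq nat) : seq R :=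
  [seq (nth 0%N c i * size c + i)%:R | i <- iota 0 (size c)].

(** Dividing by the number n of keys removes the tie-breaking index; dividing by M = 2^(L - k) then
    forgets all but the first k bits. *)
Definition key_class n M (y : R) : nat := (Num.truncn y %/ n %/ M)%N.

Lemma size_keys c : size (keys c) = size c.
Proof. by rewrite size_map size_iota. Qed.

Lemma uniq_keys c : uniq (keys c).
Proof.
rewrite map_inj_in_uniq ?iota_uniq// => i j; rewrite !mem_iota !add0n/= => ic jc.
by move=> /eqP; rewrite eqr_nat => /eqP /(congr1 (modn^~ (size c))); rewrite !modnMDl !modn_small.
Qed.

Lemma truncn_key c i : (i < size c)%N ->
  (Num.truncn ((nth 0%N c i * size c + i)%:R : R) %/ size c)%N = nth 0%N c i.
Proof.
move=> ic; rewrite natrK divnMDl ?divn_small ?addn0//.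
exact: leq_ltn_trans ic.
Qed.

Lemma key_class_size M I c :
  class_size (key_class (size c) M) I (keys c) = cell_size (fun x => x %/ M)%N I c.
Proof.
rewrite /class_size /cell_size /keys count_map -[in RHS](mkseq_nth 0%N c) /mkseq count_map.
apply: eq_in_count => i; rewrite mem_iota add0n => /andP[_ ic] /=.
by rewrite /key_class truncn_key.
Qed.

Lemma le_key_class n M : {homo key_class n M : x y / x <= y >-> (x <= y)%N}.
Proof. by move=> x y /le_truncn xy; rewrite /key_class !leq_div2r. Qed.

Lemma key_class_lt L k c y : (k <= L)%N -> all (fun x => x < 2 ^ L)%N c -> y \in keys c ->
  (key_class (size c) (2 ^ (L - k)) y < 2 ^ k)%N.
Proof.
move=> kL mc /mapP[i]; rewrite mem_iota add0n => /andP[_ ic] ->.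
rewrite /key_class truncn_key// ltn_divLR ?expn_gt0// -expnD subnKC//.
by apply: (allP mc); exact: mem_nth.
Qed.

Lemma law_keys_le L k c b : (k <= L)%N -> all (fun x => x < 2 ^ L)%N c ->
  law (same_class (key_class (size c) (2 ^ (L - k)))) (size c) (keys c)
    (fun x => (x%:R - b) ^+ 2) <=
  cell_sum (2 ^ k) (fun x => x %/ 2 ^ (L - k))%N var_bound c +
  (cell_sum (2 ^ k) (fun x => x %/ 2 ^ (L - k))%N mean_cost c - b) ^+ 2.
Proof.
move=> kL mc; have kK x : x \in keys c -> _ := @key_class_lt L k c x kL mc.
have := law_sqr_le (@le_key_class (size c) (2 ^ (L - k))) b (uniq_keys c) kK (m := size c).
rewrite size_keys leqnn => /(_ isT).
by rewrite /class_sum /cell_sum; under eq_bigr do rewrite key_class_size;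
   under [X in _ + (X - _) ^+ 2]eq_bigr do rewrite key_class_size.
Qed.

(** The function f_k of the overview: 2^k times the mean of [mean_cost] at a binomial variable with
    parameters n and 2^-k. *)
Definition level_mean k n : R := (2 ^ k)%:R * iter n (mean_step (2 ^ k)%:R^-1) mean_cost 0%N.

Lemma avg_law_le L k n b : (k <= L)%N ->
  avg (2 ^ L) n (fun c => law (same_class (key_class n (2 ^ (L - k)))) n (keys c)
    (fun x => (x%:R - b) ^+ 2)) <=
  87 * (2 ^ k)%:R^-1 * (n%:R * (n%:R - 1)) + (level_mean k n - b) ^+ 2.
Proof.
move=> kL; have m0 : (0 < 2 ^ L)%N by rewrite expn_gt0.
have K0 : (0 < 2 ^ k)%N by rewrite expn_gt0.
have kK x : (x < 2 ^ L)%N -> (x %/ 2 ^ (L - k) < 2 ^ k)%N.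
  by move=> xL; rewrite ltn_divLR ?expn_gt0// -expnD subnKC.
have ku h := block_unif h kL.
apply: (@le_trans _ _ (avg (2 ^ L) n (fun c =>
   cell_sum (2 ^ k) (fun x => x %/ 2 ^ (L - k))%N var_bound c +
  (cell_sum (2 ^ k) (fun x => x %/ 2 ^ (L - k))%N mean_cost c - b) ^+ 2))).
  by apply: avg_le => c sc mc; rewrite -sc; exact: law_keys_le.
rewrite avgD (avg_cell_sum_var_bound m0 K0 kK ku).
have h : forall a, (mean_cost a.+1 - mean_cost a) ^+ 2 <= 12 * a%:R + 0 :> R.
  by move=> a; rewrite addr0; exact: sqr_diff_mean_cost.
have := avg_sqr_cell_sum m0 K0 kK ku n b h; rewrite -/(level_mean k n) addr0.
lra.
Qed.

Lemma sqr_diff_level_mean k n :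
  (level_mean k n.+1 - level_mean k n) ^+ 2 <= 12 * (2 ^ k)%:R^-1 * n%:R.
Proof.
have K0 : (0 < 2 ^ k)%N by rewrite expn_gt0.
exact: (sqr_diff_mean_fun K0 n sqr_diff_mean_cost).
Qed.

End Cells.

(** * The discretised cost *)

Section DiscretisedCost.
Context {d : measure_display} {T : measurableType d} {R : realType}.
Variables (P : probability T R) (N : {RV P >-> nat}) (X : nat -> {RV P >-> R})
  (J : seq bool -> nat -> {RV P >-> nat}) (lambda : R).
Local Notation pr := (pr P).

Hypothesis lambda_gt0 : 0 < lambda.
Hypothesis N_pois : poisson_distributed lambda N.
Hypothesis X_unif : forall i, uniform01 (X i).
Hypothesis J_uord : forall w n, (2 <= n)%N -> uniform_ord n (J w n).
Hypothesis src_indep : independent_classes P (sources N X J).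

Lemma pr_N n : pr [set t | N t == n] = poisson_pmf lambda n.
Proof.
rewrite /pr (_ : [set t | _] = N @^-1` [set n]) ?N_pois//.
by apply/seteqP; split=> t /eqP.
Qed.

Lemma pr_J w n : (2 <= n)%N -> forall i, (i < n)%N -> pr [set t | J w n t == i] = n%:R^-1.
Proof.
move=> n2 i ni; rewrite /pr (_ : [set t | _] = J w n @^-1` [set i]) ?J_uord//.
by apply/seteqP; split=> t /eqP.
Qed.

Lemma pr_cell L i c : (c < 2 ^ L)%N -> pr [set t | cell L (X i t) == c] = (2 ^ L)%:R^-1.
Proof.
move=> cL; rewrite /pr (_ : [set t | _] = X i @^-1` (cell L @^-1` [set c])).
  by have := X_unif i (measurable_cell L c); rewrite /distribution/pushforward => ->; rewrite uniform_cell.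
by apply/seteqP; split=> t /eqP.
Qed.

Lemma disc_cell L i : disc (fun t => cell L (X i t)).
Proof.
apply: disc_points => c.
rewrite -[X in measurable X]setTI -[X in _ `&` X]/(X i @^-1` (cell L @^-1` [set c])).
by apply: measurable_funP => //; exact: measurable_cell.
Qed.

Lemma disc_cells L n : disc (fun t => mkseq (fun i => cell L (X i t)) n).
Proof.
elim: n => [|n IH]; first exact: (disc_cst [::]).
rewrite [X in disc X](_ : _ = fun t => rcons (mkseq (fun i => cell L (X i t)) n) (cell L (X n t))).
  apply: (disc_dep (H := fun c t => rcons c (cell L (X n t)))) => // c.
  by apply: (disc_comp (rcons c)); exact: disc_cell.
by apply/funext => t; rewrite mkseqS.
Qed.

(** The pair cost takes the number of keys as an argument because decoding a key with [key_class]
    needs it. *)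
Definition cost_at L (F : nat -> R -> R -> nat) t : nat :=
  total_cost (F (N t)) (N t) (pivots J [::] t) (@keys R (mkseq (fun i => cell L (X i t)) (N t))).

Lemma disc_cost_at L F : disc (cost_at L F).
Proof.
apply: (disc_dep (H := fun n t => total_cost (F n) n (pivots J [::] t)
  (@keys R (mkseq (fun i => cell L (X i t)) n)))); first exact: disc_RV.
move=> n; apply: (disc_dep (H := fun c t => total_cost (F n) n (pivots J [::] t) (@keys R c))).
  exact: disc_cells.
by move=> c; exact: disc_total_cost.
Qed.

Fixpoint cells_at L r (c : seq nat) (t : T) : bool :=
  if c is x :: c' then (cell L (X r t) == x) && cells_at L r.+1 c' t else true.

Lemma cells_atE L r c t : cells_at L r c t =
  (mkseq (fun i => cell L (X (r + i) t)) (size c) == c).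
Proof.
elim: c r => [|x c IH] r //=.
rewrite IH /mkseq /= eqseq_cons addn0; congr (_ && (_ == _)).
rewrite -(addn0 1%N) iotaDl -map_comp; apply: eq_map => i /=.
by rewrite add1n addnS.
Qed.

Lemma disc_cells_at L r c : disc (cells_at L r c).
Proof.
elim: c r => [|x c IH] r; first exact: (disc_cst true).
apply: (disc_dep (H := fun b t => b && cells_at L r.+1 c t)).
  by apply: (disc_comp (fun y => y == x)); exact: disc_cell.
by move=> b; exact: (disc_comp (andb b)).
Qed.

Lemma measurable_N_cells L n r c : measurable ([set t | N t == n] `&` [set t | cells_at L r c t]).
Proof.
apply: measurableI; last exact: (disc_event (disc_cells_at L r c)).
by apply: disc_event; apply: (disc_comp (fun x => x == n)); exact: disc_RV.
Qed.

(** The joint law of N, finitely many cells and finitely many pivots, from the independence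
    hypothesis applied to the list [s] of sources. *)
Lemma pr_N_cells_pivots L n c ls e : all (fun x => x < 2 ^ L)%N c -> uniq ls ->
  pr ([set t | N t == n] `&` [set t | cells_at L 0 c t] `&` pivots_at J [::] ls e) =
  poisson_pmf lambda n * (2 ^ L)%:R^-1 ^+ size c *
  \prod_(j <- ls) pr [set t | J j.1 j.2 t == e j].
Proof.
move=> mc uls.
pose E (i : unit + nat + seq bool * nat) : set T := match i with
  | inl (inl _) => [set t | N t == n]
  | inl (inr i) => [set t | cell L (X i t) == nth 0%N c i]
  | inr (w, k) => [set t | J w k t == e (w, k)] end.
pose s : seq (unit + nat + seq bool * nat) :=
  inl (inl tt) :: [seq inl (inr i) | i <- iota 0 (size c)] ++ [seq inr j | j <- ls].
have us : uniq s.
  rewrite /= mem_cat cat_uniq !map_inj_uniq ?iota_uniq ?uls//; last 2 first.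
  - by move=> ? ? [].
  - by move=> ? ? [].
  rewrite andbT; apply/andP; split; first by apply/negP => /orP[]/mapP[].
  by apply/hasPn => _ /mapP[j _ ->]; apply/negP => /mapP[].
have sE i : i \in s -> sources N X J i (E i).
  move=> _; case: i => [[[]|i]|[w k]] /=.
  - by exists [set n] => //; rewrite setTI; apply/seteqP; split=> t /eqP.
  - exists (cell L @^-1` [set nth 0%N c i]); first exact: measurable_cell.
    by rewrite setTI; apply/seteqP; split=> t /eqP.
  - by exists [set e (w, k)] => //; rewrite setTI; apply/seteqP; split=> t /eqP.
have := src_indep us sE.
rewrite (_ : \bigcap_(i in _) _ = [set t | N t == n] `&` [set t | cells_at L 0 c t]
    `&` pivots_at J [::] ls e); last first.
  apply/funext => t; apply/propext; split.
    move=> h; split; first split.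
    - by apply: (h (inl (inl tt))); rewrite /= mem_head.
    - rewrite /= cells_atE; apply/eqP/(@eq_from_nth _ 0%N); rewrite size_mkseq// => i ic.
      rewrite nth_mkseq// add0n; apply/eqP; apply: (h (inl (inr i))).
      rewrite /s/= inE mem_cat; apply/orP; right; apply/orP; left.
      by apply: map_f; rewrite mem_iota.
    - rewrite /pivots_at /=; apply/allP => -[w k] jl /=; apply: (h (inr (w, k))).
      by rewrite /s/= inE mem_cat; apply/orP; right; apply/orP; right; exact: map_f.
  move=> [[/= h1 h2] h3] i; rewrite /s/= inE mem_cat => /orP[/eqP->//|/orP[]/mapP[]].
    move=> j; rewrite mem_iota add0n => /andP[_ jc] -> /=.
    by rewrite cells_atE in h2; rewrite -(eqP h2) nth_mkseq.
  by move=> [w k] jl -> /=; have := allP h3 _ jl.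
rewrite /s big_cons big_cat/= !big_map => h; rewrite /pr h.
have mJ j : measurable [set t | J j.1 j.2 t == e j].
  by apply: disc_event; apply: (disc_comp (fun x => x == e j)); exact: disc_RV.
have mX i : measurable [set t | cell L (X i t) == nth 0%N c i].
  by apply: disc_event; apply: (disc_comp (fun x => x == nth 0%N c i)); exact: disc_cell.
have mN : measurable [set t | N t == n].
  by apply: disc_event; apply: (disc_comp (fun x => x == n)); exact: disc_RV.
rewrite [X in (_ * (X * _))%E](eq_bigr (fun i => (pr [set t | cell L (X i t) == nth 0%N c i])%:E)); last first.
  by move=> i _; rewrite -prE.
rewrite [X in (_ * (_ * X))%E](eq_bigr (fun j => (pr [set t | J j.1 j.2 t == e j])%:E)); last first.
  by move=> [w k] _; rewrite -prE.
rewrite !prodEFin (prE P mN) pr_N -!EFinM/= mulrA; congr (_ * _ * _).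
rewrite (eq_big_seq (fun=> (2 ^ L)%:R^-1)); last first.
  move=> i; rewrite mem_iota add0n => /andP[_ ic]; rewrite pr_cell//.
  by apply: (allP mc); exact: mem_nth.
by rewrite big_const_seq count_predT size_iota iter_mulr_1.
Qed.

Lemma indep_below_N_cells L n c : all (fun x => x < 2 ^ L)%N c ->
  indep_below J [::] ([set t | N t == n] `&` [set t | cells_at L 0 c t]) /\
  pr ([set t | N t == n] `&` [set t | cells_at L 0 c t]) =
    poisson_pmf lambda n * (2 ^ L)%:R^-1 ^+ size c.
Proof.
move=> mc.
have prE0 : pr ([set t | N t == n] `&` [set t | cells_at L 0 c t]) =
    poisson_pmf lambda n * (2 ^ L)%:R^-1 ^+ size c.
  have := @pr_N_cells_pivots L n c [::] (fun=> 0%N) mc isT.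
  by rewrite big_nil mulr1 (_ : pivots_at _ _ _ _ = setT) ?setIT//; apply/seteqP; split.
split=> //; split; first exact: measurable_N_cells.
by move=> ls e uls; rewrite pr_N_cells_pivots// prE0.
Qed.

(** Keys of index below [r] are averaged and those from [r] on have prescribed cells. At [r = 0] all
    cells are prescribed and [pr_total_cost] applies; each step of the induction frees one more
    key. *)
Lemma pr_cost_cells L (F : nat -> R -> R -> nat) n r c (phi : pred nat) :
  (forall x y, F n x y <= 1)%N ->
  all (fun x => x < 2 ^ L)%N c -> (r + size c = n)%N ->
  pr ([set t | N t == n] `&` [set t | cells_at L r c t] `&` [set t | phi (cost_at L F t)]) =
  poisson_pmf lambda n * (2 ^ L)%:R^-1 ^+ size c *
  avg (2 ^ L) r (fun c' => law (F n) n (@keys R (c' ++ c)) (fun x => (phi x)%:R)).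
Proof.
move=> F1; elim: r c => [|r IH] c mc /=.
  rewrite add0n => sc; have [iA prA] := indep_below_N_cells n mc.
  rewrite -prA -(pr_total_cost pr_J phi F1 iA) ?size_keys ?sc//; congr pr.
  rewrite -!setIA; apply/seteqP; split=> t /= [/eqP Nt [ct]]; rewrite /cost_at Nt;
    by move: (ct); rewrite cells_atE sc => /eqP ->.
move=> rn; have mphi : measurable [set t | phi (cost_at L F t)].
  by apply: disc_event; apply: (disc_comp phi); exact: disc_cost_at.
rewrite (@pr_split _ _ _ P (fun t => cell L (X r t)) (2 ^ L)%N); first last.
- rewrite (eq_bigr (fun=> (2 ^ L)%:R^-1)) => [|i _]; last by rewrite pr_cell.
  by rewrite sumr_const card_ord -[_^-1 *+ _]mulr_natl mulfV// pnatr_eq0 -lt0n expn_gt0.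
- by apply: measurableI => //; exact: measurable_N_cells.
- exact: disc_cell.
rewrite (eq_bigr (fun x : 'I_(2 ^ L) => poisson_pmf lambda n * (2 ^ L)%:R^-1 ^+ (size c).+1 *
    avg (2 ^ L) r (fun c' => law (F n) n (@keys R (rcons c' x ++ c)) (fun x => (phi x)%:R)))).
  rewrite -mulr_sumr -avg_sum ?expn_gt0// avgZ exprSr !mulrA.
  by [].
move=> x _; rewrite (@eq_avg _ _ _ _ (fun c' => law (F n) n (@keys R (c' ++ val x :: c))
  (fun x => (phi x)%:R))); last by move=> c'; rewrite cat_rcons.
rewrite -(IH (val x :: c)) /= ?ltn_ord// ?addnS//; congr pr.
by apply/seteqP; split=> t /=; [move=> [[[-> ->] ->] ->]|move=> [[-> /andP[-> ->]] ->]].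
Qed.

Lemma integral_cost_at L (F : nat -> R -> R -> nat) (psi : nat -> R) :
  (forall n x y, F n x y <= 1)%N -> (forall x, 0 <= psi x) ->
  (\int[P]_t (psi (cost_at L F t))%:E = \sum_(n <oo) (poisson_pmf lambda n *
    avg (2 ^ L) n (fun c => law (F n) n (@keys R c) psi))%:E)%E.
Proof.
move=> F1 psi0; pose A n := [set t | N t == n].
have mA n : measurable (A n).
  by apply: disc_event; apply: (disc_comp (fun x => x == n)); exact: disc_RV.
have mV (V : T -> nat) : disc V -> measurable_fun setT (EFin \o (psi \o V)).
  move=> dV; apply/measurable_EFinP => _ B mB; rewrite setTI.
  exact: (disc_comp psi dV B).
have UA : \bigcup_n A n = setT by apply/seteqP; split=> t // _; exists (N t) => //=; exact: eqxx.
rewrite -UA ge0_integral_bigcup//; first last.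
- by move=> i j _ _ [t [/eqP <- /eqP]].
- by move=> t _; rewrite lee_fin.
- by rewrite UA; apply: mV; exact: disc_cost_at.
(* On the event N = n the cost is at most n^2, so its integral is a finite sum over its values. *)
apply: eq_eseriesr => n _; pose b := (n ^ 2).+1.
have mE x : measurable [set t | cost_at L F t == x].
  by apply: disc_event; apply: (disc_comp (fun y => y == x)); exact: disc_cost_at.
rewrite (eq_integral (fun t => \sum_(x < b) ((psi x)%:E * (\1_[set t | cost_at L F t == x] t)%:E)))%E.
  rewrite ge0_integral_sum//; first last.
  - by move=> x t _; rewrite mule_ge0// lee_fin.
  - move=> x; apply: measurable_funeM; apply/measurable_EFinP.
    by apply: measurable_funTS; exact: measurable_indic.
  rewrite (eq_bigr (fun x : 'I_b => (psi x * (poisson_pmf lambda n * avg (2 ^ L) n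
      (fun c => law (F n) n (@keys R (c ++ [::])) (fun y => (y == x)%:R))))%:E)); last first.
    move=> x _; rewrite ge0_integralZl_EFin//; last first.
    - by apply/measurable_EFinP/measurable_funTS; exact: measurable_indic.
    transitivity ((psi x)%:E * P (A n `&` [set t | cost_at L F t == x]))%E.
      by rewrite integral_indic// setIC.
    rewrite (prE P); last exact: measurableI.
    rewrite (_ : A n `&` _ = A n `&` [set t | cells_at L n [::] t] `&` [set t | cost_at L F t == x]); last first.
      by rewrite -setIA; congr (_ `&` _); apply/seteqP; split=> t //= [].
    by rewrite (@pr_cost_cells L F n n [::] (fun y => y == x))// ?addn0// expr0 mulr1 -EFinM.
  rewrite sumEFin; congr _%:E.
  rewrite (eq_bigr (fun x : 'I_b => poisson_pmf lambda n * avg (2 ^ L) n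
     (fun c => psi x * law (F n) n (@keys R c) (fun y => (y == x)%:R)))); last first.
    move=> x _; rewrite avgZ mulrCA; congr (_ * (_ * _)).
    by apply: eq_avg => c; rewrite cats0.
  rewrite -mulr_sumr -avg_sum ?expn_gt0//; congr (_ * _); apply/eqP; rewrite eq_le.
  by apply/andP; split; apply: avg_le => c sc _; rewrite (@law_expand _ _ _ _ psi b)// size_keys sc.
move=> t; rewrite inE/= => /eqP Nt; rewrite -[RHS](big_mkord xpredT
  (fun x => ((psi x)%:E * (\1_[set t | cost_at L F t == x] t)%:E)%E)).
have cb : (cost_at L F t < b)%N.
  rewrite ltnS (leq_trans (total_cost_le _ _ _ (F1 _)))// size_keys size_mkseq Nt//.
rewrite (bigD1_seq (cost_at L F t)) ?mem_index_iota ?iota_uniq//= indicE mem_set/= ?eqxx// mule1.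
rewrite big1 ?adde0// => x xc; rewrite indicE memNset ?mule0//= => /eqP e.
by rewrite e eqxx in xc.
Qed.

Definition level_cost L k n : R -> R -> nat := same_class (key_class n (2 ^ (L - k))).

Lemma integral_level_cost L k : (k <= L)%N ->
  (\int[P]_t (((cost_at L (level_cost L k) t)%:R - level_mean k (Num.truncn lambda)) ^+ 2)%:E
   <= (207 * (2 ^ k)%:R^-1 * lambda ^+ 2)%:E)%E.
Proof.
move=> kL; set b := level_mean k _.
rewrite (integral_cost_at L (psi := fun x => (x%:R - b) ^+ 2)); last 2 first.
- by move=> n x y; rewrite /level_cost /same_class leq_b1.
- by move=> x; exact: sqr_ge0.
apply: le_trans (poisson_sqr_dev lambda_gt0 _ (sqr_diff_level_mean k)); last by rewrite invr_ge0.
apply: lee_nneseries => n _ *; rewrite lee_fin.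
  rewrite mulr_ge0 ?poisson_pmf_ge0// -[X in X <= _](avg_cst n 0 (m := 2 ^ L)) ?expn_gt0//.
  apply: avg_le => c _ _; rewrite -[X in X <= _](law_cst (level_cost L k n) n (@keys R c) 0).
  by apply: law_le => x; exact: sqr_ge0.
by rewrite ler_wpM2l ?poisson_pmf_ge0//; exact: avg_law_le.
Qed.

End DiscretisedCost.

(** * Bit costs and cells *)

Section OrderInvariance.
Context {R : realType}.
Implicit Types (s : seq R) (J : seq bool -> nat -> nat).

(** If b is the first differing bit, exactly the b prefixes of lengths 0, ..., b - 1 agree. This is
    the decomposition of B into the B_k. *)
Lemma bit_cost_sum L (x y : R) : cell 0 x = cell 0 y -> cell L x != cell L y ->
  bit_cost x y = (\sum_(k < L) (cell k x == cell k y))%N.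
Proof.
move=> xy0 xyL.
have bitE z k : bit z k = odd (cell k z) by [].
have cS k : (cell k.+1 x == cell k.+1 y) = (bit x k.+1 == bit y k.+1) && (cell k x == cell k y).
  rewrite !bitE; have := cell_half k x; have := cell_half k y.
  have := odd_double_half (cell k.+1 x); have := odd_double_half (cell k.+1 y).
  set a := cell k.+1 x; set b := cell k.+1 y; move=> hb ha <- <-.
  apply/eqP/andP => [->//|[/eqP h1 /eqP h2]].
  by rewrite -ha -hb h1 h2.
rewrite /bit_cost; case: pselect => [h|nh]; last first.
  case/negP: xyL; elim: L => [|L IH]; first exact/eqP.
  by rewrite cS IH andbT; apply/negP => /negP xyb; apply: nh; exists L.+1.
case: ex_minnP => b /andP[b0 hb] bmin.
have lt_b k : (k < b)%N -> cell k x == cell k y.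
  elim: k => [_|k IH kb]; first exact/eqP.
  rewrite cS (IH (ltnW kb)) andbT; apply/negP => /negP xyk.
  by have := bmin k.+1; rewrite xyk => /(_ isT); rewrite leqNgt kb.
have ge_b k : (b <= k)%N -> cell k x != cell k y.
  move=> bk; apply/negP => /eqP e.
  have : cell b x == cell b y by rewrite !(cell_divn _ bk) e.
  by case: (b) b0 hb => // b' _ hb; rewrite cS => /andP[]; rewrite (negbTE hb).
have bL : (b <= L)%N by rewrite leqNgt; apply/negP => /lt_b; rewrite (negbTE xyL).
rewrite (eq_bigr (fun k : 'I_L => (k < b)%N : nat)); last first.
  by move=> k _; case: ltnP => [/lt_b->|/ge_b/negbTE->].
rewrite -(big_mkord xpredT (fun k => (k < b)%N : nat)) (big_cat_nat (n := b))//=.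
rewrite [X in (_ + X)%N](_ : _ = 0%N); last first.
  by rewrite big_nat_cond big1// => k /andP[/andP[bk _] _]; rewrite ltnNge bk.
rewrite addn0 big_nat_cond (eq_bigr (fun=> 1%N)); last by move=> k /andP[/andP[_ ->] _].
by rewrite -big_nat_cond sum_nat_const_nat subn0 muln1.
Qed.

Lemma mono_uniq_map (g : R -> R) s : {homo g : x y / x <= y} -> uniq (map g s) ->
  {in s &, {mono g : x y / x < y}}.
Proof.
move=> le_g us x y xs ys; case: (ltgtP x y) => [xy|/ltW/le_g yx|->]; last by rewrite ltxx.
  rewrite lt_neqAle (le_g _ _ (ltW xy)) andbT; apply/negP => /eqP gxy.
  move: xy; suff -> : x = y by rewrite ltxx.
  have iE z : z \in s -> index (g z) (map g s) = index z s.
    move=> zs; rewrite -[in LHS](nth_index 0 zs) -(nth_map 0 (g 0)) ?index_mem//.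
    by rewrite index_uniq// size_map index_mem.
  by rewrite -(nth_index 0 xs) -(iE _ xs) gxy (iE _ ys) nth_index.
by rewrite ltNge yx.
Qed.

Lemma comparisons_rec_map (g : R -> R) m J s : {in s &, {mono g : x y / x < y}} ->
  comparisons_rec m J (map g s) = [seq (g c.1, g c.2) | c <- comparisons_rec m J s].
Proof.
elim: m J s => // m IH J s gs /=; rewrite size_map; case: ifPn => // s1.
rewrite -ltnNge in s1; set i := J [::] (size s); set p := nth (head 0 s) s i.
have ps : p \in s by exact: pivot_mem.
have -> : nth (head 0 (map g s)) (map g s) i = g p.
  rewrite /p; case: (s) s1 => // x s' _.
  have [h|h] := ltnP i (size (x :: s')); first by rewrite (nth_map (head 0 (x :: s'))).
  by rewrite !nth_default// size_map.
have gne x : x \in s -> (g x != g p) = (x != p).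
  by move=> xs; rewrite !neq_lt !gs.
rewrite !filter_map !map_cat -!map_comp; congr (_ ++ (_ ++ _)).
- by rewrite (@eq_in_filter _ (preim g (fun x => x != g p)) (fun x => x != p))//; exact: gne.
- rewrite (@eq_in_filter _ (preim g (fun x => x < g p)) (fun x => x < p)) ?IH ?map_comp//.
    by move=> x y; rewrite !mem_filter => /andP[_ xs] /andP[_ ys]; exact: gs.
  by move=> x xs /=; exact: gs.
- rewrite (@eq_in_filter _ (preim g (fun x => g p < x)) (fun x => p < x)) ?IH ?map_comp//.
    by move=> x y; rewrite !mem_filter => /andP[_ xs] /andP[_ ys]; exact: gs.
  by move=> x xs /=; exact: gs.
Qed.

Lemma mem_comparisons_rec m J s c : c \in comparisons_rec m J s ->
  [/\ c.1 \in s, c.2 \in s & c.1 != c.2].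
Proof.
elim: m J s => // m IH J s /=; case: ifPn => // s1.
rewrite -ltnNge in s1; have := pivot_mem (J [::] (size s)) s1; set p := nth _ _ _ => ps.
rewrite !mem_cat => /orP[/mapP[x]|/orP[]/IH[]].
- by rewrite mem_filter => /andP[xp xs] ->.
- by rewrite !mem_filter => /andP[_ ->] /andP[_ ->].
- by rewrite !mem_filter => /andP[_ ->] /andP[_ ->].
Qed.

Lemma total_cost_map f (g : R -> R) m J s : {in s &, {mono g : x y / x < y}} ->
  total_cost f m J (map g s) = total_cost (fun x y => f (g x) (g y)) m J s.
Proof. by move=> gs; rewrite /total_cost comparisons_rec_map// big_map. Qed.

Lemma bit_comparisons_cells L J s :
  uniq (map (cell L) s) -> {in s, forall x, cell 0 x = 0%N} ->
  bit_comparisons J s = (\sum_(k < L)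
    @total_cost R (same_class (key_class (size s) (2 ^ (L - k)))) (size s) J
      (keys (map (cell L) s)))%N.
Proof.
move=> us s0; set c := map (cell L) s; set n := size s.
have cn : size c = n by rewrite size_map.
pose H (x y : R) := (\sum_(k < L)
  (Num.truncn x %/ 2 ^ (L - k) == Num.truncn y %/ 2 ^ (L - k)))%N.
have L0 : 0 <= 2 ^+ L :> R by rewrite exprn_ge0.
(* Real and synthetic keys are compared through their common image, the list of cells: both maps are
   monotone, and injective on the keys because the cells are distinct, so Quicksort makes
   corresponding comparisons. *)
pose g1 (x : R) : R := (cell L x)%:R; pose g2 (y : R) : R := (Num.truncn y %/ n)%:R.
have le_g1 : {homo g1 : x y / x <= y}.
  by move=> x y xy; rewrite ler_nat le_truncn// ler_wpM2l.
have le_g2 : {homo g2 : x y / x <= y}.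
  by move=> x y /le_truncn xy; rewrite ler_nat leq_div2r.
have natr_uniq : uniq (map (fun x : nat => x%:R : R) c).
  by rewrite map_inj_uniq// => x y /eqP; rewrite eqr_nat => /eqP.
have g1E : map g1 s = map (fun x : nat => x%:R : R) c by rewrite -map_comp.
have g2E : map g2 (keys c) = map (fun x : nat => x%:R : R) c.
  rewrite -map_comp -[in RHS](mkseq_nth 0%N c) /mkseq -[in RHS]map_comp.
  apply/eq_in_map => i; rewrite mem_iota add0n => /andP[_ ic] /=.
  by rewrite /g2 -cn truncn_key.
have g1s := mono_uniq_map le_g1 (s := s); rewrite g1E in g1s.
have g2s := mono_uniq_map le_g2 (s := keys c); rewrite g2E in g2s.
transitivity (total_cost (fun x y => H (g1 x) (g1 y)) n J s).
  rewrite /bit_comparisons /comparisons /total_cost; apply: eq_big_seq => -[x y].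
  move=> /mem_comparisons_rec[/= xs ys xy].
  rewrite (@bit_cost_sum L); first last.
  - have : g1 x != g1 y by move: xy; rewrite !neq_lt !(g1s natr_uniq).
    by rewrite /g1 eqr_nat.
  - by rewrite !s0.
  apply: eq_bigr => k _; rewrite /g1 !natrK.
  by rewrite !(@cell_divn _ L k)// ltnW.
rewrite -total_cost_map; last exact: g1s.
rewrite g1E -g2E total_cost_map; last exact: g2s.
rewrite /total_cost [RHS]exchange_big/=; apply: eq_bigr => -[x y] _.
by apply: eq_bigr => k _; rewrite /g2 !natrK.
Qed.

End OrderInvariance.

(** * Variance and null sets *)

Section Variance.
Context {d : measure_display} {T : measurableType d} {R : realType}.
Variable P : probability T R.

Import HBNNSimple.

(** The integral of a nonnegative function is a supremum over simple functions below it. Multiplying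
    such a function by the indicator of the complement of [B] keeps its integral and brings it below
    [g]; measurability of [f] and [g] does not enter. *)
Lemma ge0_le_integral_off_null (f g : T -> \bar R) (B : set T) :
  measurable B -> P B = 0%E -> (forall t, 0 <= f t)%E -> (forall t, 0 <= g t)%E ->
  (forall t, ~ B t -> f t <= g t)%E -> (\int[P]_t f t <= \int[P]_t g t)%E.
Proof.
move=> mB PB0 f0 g0 fg; rewrite !ge0_integralTE//.
apply/ge_ereal_sup => /= _ [h hf <-].
pose h' := mul_nnsfun h (indic_nnsfun R (measurableC mB)).
apply: (@le_trans _ _ (sintegral P h')); last first.
  apply: ereal_sup_ubound; exists h' => //= t.
  rewrite /= /mindic indicE; case: (boolP (t \in ~` B)) => [/set_mem Bt|_].
    by rewrite mulr1 (le_trans (hf t))// fg.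
  by rewrite mulr0.
have e (k : {nnsfun T >-> R}) : sintegral P k = (\int[P]_t (k t)%:E)%E.
  by rewrite integral_nnsfun// patch_setT.
rewrite !e le_eqVlt; apply/orP; left; apply/eqP; apply: ge0_ae_eq_integral => //.
- by apply/measurable_EFinP.
- by apply/measurable_EFinP.
- by move=> t _; rewrite lee_fin.
- by move=> t _; rewrite lee_fin.
exists B; split=> // t /=; apply: contra_notP => Bt _.
by rewrite /mindic indicE mem_set// mulr1.
Qed.

Lemma ge0_eq_integral_off_null (f g : T -> \bar R) (B : set T) :
  measurable B -> P B = 0%E -> (forall t, 0 <= f t)%E -> (forall t, 0 <= g t)%E ->
  (forall t, ~ B t -> f t = g t)%E -> (\int[P]_t f t = \int[P]_t g t)%E.
Proof.
move=> mB PB0 f0 g0 fg; apply/eqP; rewrite eq_le.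
by apply/andP; split; apply: (ge0_le_integral_off_null mB PB0) => // t Bt; rewrite fg.
Qed.

(* [Y] need not be measurable: the cost of Quicksort agrees with a limit of
   measurable functions only off a null set. *)
Lemma eq_variance_off_null (Y Z : T -> R) (B : set T) :
  measurable B -> P B = 0%E -> (forall t, 0 <= Y t) -> (forall t, 0 <= Z t) ->
  (forall t, ~ B t -> Y t = Z t) -> ('V_P[Y] = 'V_P[Z])%E.
Proof.
move=> mB PB0 Y0 Z0 YZ.
have EYZ : ('E_P[Y] = 'E_P[Z])%E.
  rewrite !unlock; apply: (ge0_eq_integral_off_null mB PB0).
  - by move=> t; rewrite lee_fin.
  - by move=> t; rewrite lee_fin.
  - by move=> t Bt; rewrite YZ.
rewrite /variance !covariance.unlock EYZ; set m := fine _.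
rewrite !expectation.unlock; apply: (ge0_eq_integral_off_null mB PB0).
- by move=> t; rewrite lee_fin -expr2 sqr_ge0.
- by move=> t; rewrite lee_fin -expr2 sqr_ge0.
- by move=> t Bt; rewrite -[LHS]/(((Y t - m) * (Y t - m))%:E) YZ.
Qed.

(** The mean m is the best centre: the variance is the mean of (Y - a)^2 minus (a - m)^2.
    Integrability of [Y] comes from |Y| <= (Y - a)^2 + 1 + |a|. *)
Lemma variance_le_sqr_dev (Y : T -> R) (a C : R) : measurable_fun setT Y ->
  (\int[P]_t ((Y t - a) ^+ 2)%:E <= C%:E)%E -> ('V_P[Y] <= C%:E)%E.
Proof.
move=> mY YC.
have mS : measurable_fun setT (fun t => (Y t - a) ^+ 2).
  by apply: measurable_funX; exact: measurable_funB.
have iS : P.-integrable setT (EFin \o (fun t => (Y t - a) ^+ 2)).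
  apply/integrableP; split; first exact/measurable_EFinP.
  under eq_integral => t _ do rewrite /= ger0_norm ?sqr_ge0//.
  exact: le_lt_trans YC (ltry _).
have icst (r : R) : P.-integrable setT (EFin \o cst r).
  exact/Lfun1_integrable/Lfun_cst.
have iY : P.-integrable setT (EFin \o Y).
  apply: (@le_integrable _ _ _ P setT measurableT _
    (EFin \o (fun t => (Y t - a) ^+ 2 + (1 + `|a|)))).
  - exact/measurable_EFinP.
  - move=> t _ /=; rewrite lee_fin.
    rewrite [leRHS]ger0_norm; last by rewrite !addr_ge0 ?sqr_ge0.
    have : `|Y t| <= `|Y t - a| + `|a| by rewrite -{1}(subrK a (Y t)) ler_normD.
    have : `|Y t - a| <= (Y t - a) ^+ 2 + 1.
      rewrite -[X in X + 1]real_normK ?num_real//.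
      by have := sqr_ge0 (`|Y t - a| - 1); have := normr_ge0 (Y t - a); nra.
    lra.
  - by have := integrableD measurableT iS (icst (1 + `|a|)).
have LY : Y \in Lfun P 1 by exact/Lfun1_integrable.
have LS : (fun t => (Y t - a) ^+ 2) \in Lfun P 1 by exact/Lfun1_integrable.
set m := fine ('E_P[Y])%E.
have EY : ('E_P[Y] = m%:E)%E by rewrite fineK// expectation_fin_num.
have LZ : ((2 * (a - m)) \o* Y)%R \in Lfun P 1.
  by apply/Lfun1_integrable; have := integrableZl measurableT (2 * (a - m)) iY;
    apply: eq_integrable => // t _ /=; rewrite EFinM muleC.
have Lc : cst (m ^+ 2 - a ^+ 2) \in Lfun P 1 by exact/Lfun1_integrable.
have LSZ : ((fun t => (Y t - a) ^+ 2) \+ ((2 * (a - m)) \o* Y))%R \in Lfun P 1.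
  exact: (rpredD LS LZ).
have -> : ('V_P[Y] = 'E_P[fun t => ((Y t - a) ^+ 2)%R] + (2 * (a - m))%:E * 'E_P[Y] +
    'E_P[cst (m ^+ 2 - a ^+ 2)%R])%E.
  rewrite -(expectationZl _ LY) -(expectationD LS LZ) -(expectationD LSZ Lc).
  rewrite /variance covariance.unlock; congr expectation; apply/funext => t /=.
  by rewrite -[LHS]/((Y t - m) * (Y t - m)); ring.
rewrite EY expectation_cst.
rewrite expectation.unlock; move: YC; set I := (\int[P]_t _)%E => YC.
rewrite -EFinM -addeA -EFinD.
have h : 2 * (a - m) * m + (m ^+ 2 - a ^+ 2) <= 0.
  by have := sqr_ge0 (a - m); nra.
by rewrite -[leRHS]adde0 leeD// lee_fin.
Qed.

End Variance.

(** * The limit of the discretised costs *)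

Section BitComparisonsVariance.
Context {d : measure_display} {T : measurableType d} {R : realType}.
Variables (P : probability T R) (N : {RV P >-> nat}) (X : nat -> {RV P >-> R})
  (J : seq bool -> nat -> {RV P >-> nat}) (lambda : R).
Local Notation pr := (pr P).

Hypothesis lambda_gt0 : 0 < lambda.
Hypothesis N_pois : poisson_distributed lambda N.
Hypothesis X_unif : forall i, uniform01 (X i).
Hypothesis J_uord : forall w n, (2 <= n)%N -> uniform_ord n (J w n).
Hypothesis src_indep : independent_classes P (sources N X J).

Let measurable_cell_event L i c : measurable [set t | cell L (X i t) == c].
Proof. by apply: disc_event; apply: (disc_comp (fun x => x == c)); exact: disc_cell. Qed.

Definition tie i j : set T := [set t | forall L, cell L (X i t) = cell L (X j t)].

(* Off this null set the keys lie in [0, 1) (up to negative keys, which also have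
   cell 0) and are eventually in distinct cells. *)
Definition bad : set T := (\bigcup_i [set t | cell 0 (X i t) != 0%N]) `|`
  \bigcup_i \bigcup_j (if i == j then set0 else tie i j).

Let measurable_same L i j : measurable [set t | cell L (X i t) == cell L (X j t)].
Proof.
apply: disc_event; apply: (disc_dep (H := fun c t => c == cell L (X j t))).
  exact: disc_cell.
by move=> c; apply: (disc_comp (fun x => c == x)); exact: disc_cell.
Qed.

Lemma pr_same_cell L i j : i != j ->
  pr [set t | cell L (X i t) == cell L (X j t)] = (2 ^ L)%:R^-1.
Proof.
move=> ij; have q0 : (2 ^ L)%:R != 0 :> R by rewrite pnatr_eq0 -lt0n expn_gt0.
rewrite (@pr_split _ _ _ P (fun t => cell L (X i t)) (2 ^ L)%N); first last.
- rewrite (eq_bigr (fun=> (2 ^ L)%:R^-1)) => [|c _]; last by rewrite (pr_cell X_unif).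
  by rewrite sumr_const card_ord -[_^-1 *+ _]mulr_natl mulfV.
- exact: measurable_same.
- exact: disc_cell.
rewrite (eq_bigr (fun=> (2 ^ L)%:R^-1 * (2 ^ L)%:R^-1)).
  by rewrite sumr_const card_ord -[_ *+ _]mulr_natl mulrA mulfV// mul1r.
move=> c _.
pose E (k : unit + nat + seq bool * nat) : set T :=
  if k is inl (inr k') then [set t | cell L (X k' t) == c] else setT.
have us : uniq [:: inl (inr i); inl (inr j) : unit + nat + seq bool * nat].
  by rewrite /= inE andbT; apply: contra ij => /eqP[->].
have sE k : k \in [:: inl (inr i); inl (inr j) : unit + nat + seq bool * nat] ->
    sources N X J k (E k).
  have h l : g_sigma_algebra_preimage (X l) [set t | cell L (X l t) == c].
    exists (cell L @^-1` [set (c : nat)]); first exact: measurable_cell.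
    by rewrite setTI; apply/seteqP; split=> t /eqP.
  by rewrite !inE => /orP[] /eqP -> /=; exact: h.
have := src_indep us sE; rewrite !big_cons big_nil mule1 /= => h.
rewrite {1}/pr (_ : _ `&` _ = \bigcap_(k in [set` [:: inl (inr i); inl (inr j)]]) E k); last first.
  apply/seteqP; split=> t /=.
    by move=> [/eqP tij /eqP tc] k; rewrite /= !inE => /orP[]/eqP -> /=; rewrite -?tij tc.
  move=> h'; have h1 : E (inl (inr i)) t by apply: h'; rewrite /= !inE eqxx.
  have h2 : E (inl (inr j)) t by apply: h'; rewrite /= !inE eqxx orbT.
  by rewrite (eqP h1) (eqP h2).
by rewrite h !(prE P)// -EFinM/= !(pr_cell X_unif).
Qed.

Lemma measurable_tie i j : measurable (tie i j).
Proof.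
rewrite (_ : tie i j = \bigcap_L [set t | cell L (X i t) == cell L (X j t)]).
  by apply: bigcapT_measurable => L; exact: measurable_same.
by apply/seteqP; split=> t /= h L; [move=> _; apply/eqP; exact: h|apply/eqP; exact: h].
Qed.

Lemma tie_null i j : i != j -> P (tie i j) = 0%E.
Proof.
move=> ij; rewrite (prE P (measurable_tie i j)); congr _%:E; apply/eqP.
rewrite eq_le pr_ge0 andbT; apply/ler_addgt0Pl => e e0; rewrite addr0.
(* Then 1 / e < L + 1 <= 2^L. *)
pose L := Num.truncn e^-1.
apply: (@le_trans _ _ (2 ^ L)%:R^-1).
  rewrite -(pr_same_cell L ij); apply: le_pr; [exact: measurable_tie|exact: measurable_same|].
  by move=> t /= h; apply/eqP; exact: h.
rewrite -[leRHS]invrK lef_pV2 ?posrE ?invr_gt0// ?ltr0n ?expn_gt0//.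
rewrite (le_trans (ltW (truncnS_gt _)))// ler_nat.
exact: ltn_expl.
Qed.

Lemma bad_null : measurable bad /\ P bad = 0%E.
Proof.
have m1 i : measurable [set t | cell 0 (X i t) != 0%N].
  by apply: disc_event; apply: (disc_comp (fun x => x != 0%N)); exact: disc_cell.
have m2 i j : measurable (if i == j then set0 else tie i j).
  by case: eqP => // _; exact: measurable_tie.
have mbad : measurable bad.
  apply: measurableU; first exact: bigcupT_measurable.
  by apply: bigcupT_measurable => i; exact: bigcupT_measurable.
split=> //; apply/(negligibleP P mbad)/negligibleU.
  apply: negligible_bigcup => i; apply/(negligibleP P (m1 i)).
  rewrite -[LHS]/(P [set t | cell 0 (X i t) != 0%N]) (prE P (m1 i)); congr _%:E.
  apply: (@addrI _ (pr [set t | cell 0 (X i t) == 0%N])).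
  rewrite -prU ?addr0//.
    rewrite (_ : _ `|` _ = setT) ?pr_setT ?(pr_cell X_unif) ?expn0 ?invr1//.
    by apply/seteqP; split=> t // _ /=; case: eqP; [left|right].
  by apply/seteqP; split=> t //= -[/eqP ->].
apply: negligible_bigcup => i; apply: negligible_bigcup => j.
by apply/(negligibleP P (m2 i j)); case: eqVneq => [_|ij]; [exact: measure0|exact: tie_null].
Qed.

(** Cells that differ at one level differ at all finer ones, so the maximum of the separating levels
    over the finitely many pairs works. *)
Lemma good_uniq t n : ~ bad t ->
  exists L0, forall L, (L0 <= L)%N -> uniq (mkseq (fun i => cell L (X i t)) n).
Proof.
move=> gt; have dif i j : exists L, i != j -> cell L (X i t) != cell L (X j t).
  have [ij|ij] := eqVneq i j; first by exists 0%N.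
  apply: contrapT => h; apply: gt; right; exists i => //; exists j => //.
  rewrite (negbTE ij) => L; apply: contrapT => hL; apply: h; exists L => _; exact/eqP.
have [f fP] := choice (fun ij : nat * nat => dif ij.1 ij.2).
exists (\max_(i < n) \max_(j < n) f (val i, val j)) => L L0.
apply/mkseq_uniqP => i j; rewrite !inE => ni nj cij; apply/eqP; apply: contraT => ij.
have fL : (f (i, j) <= L)%N.
  apply: leq_trans L0.
  apply: leq_trans (leq_bigmax (Ordinal ni)).
  exact: (leq_bigmax (F := fun j : 'I_n => f (i, val j)) (Ordinal nj)).
by have := fP (i, j) ij; rewrite /= !(cell_divn _ fL) cij eqxx.
Qed.

(** Levels from [L] on can be left out: once the cells of level [L] are distinct, no two keys agree
    in [L] bits. *)
Definition trunc_cost L t : nat := \sum_(k < L) cost_at N X J L (level_cost L k) t.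

Lemma good_trunc_cost t : ~ bad t -> exists L0, forall L, (L0 <= L)%N ->
  quicksort_bit_comparisons N X J t = (trunc_cost L t)%:R.
Proof.
move=> gt; have [L0 hL0] := good_uniq (N t) gt; exists L0 => L /hL0 us.
rewrite /quicksort_bit_comparisons; congr _%:R.
rewrite (@bit_comparisons_cells _ L).
- by rewrite size_mkseq /mkseq -map_comp.
- by rewrite /mkseq -map_comp.
- move=> x /mapP[i _ ->]; apply/eqP; apply: contraPT gt => h; apply.
  by left; exists i.
Qed.

(** Cauchy-Schwarz with the weights (1/3) (2/3)^k, whose sum is 1. *)
Lemma sqr_sum_le (y : nat -> R) L :
  (\sum_(k < L) y k) ^+ 2 <= \sum_(k < L) 3 * (3 / 2) ^+ k * y k ^+ 2.
Proof.
elim: L y => [|L IH] y; first by rewrite !big_ord0 expr0n.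
rewrite !big_ord_recl/= expr0 mulr1.
have := IH (fun k => y k.+1); set S := \sum_(i < L) y i.+1 => h.
have -> : \sum_(i < L) 3 * (3 / 2) ^+ (bump 0 i) * y (bump 0 i) ^+ 2 =
    3 / 2 * \sum_(k < L) 3 * (3 / 2) ^+ k * y k.+1 ^+ 2.
  by rewrite mulr_sumr; apply: eq_bigr => i _; rewrite /bump/= add1n exprS; ring.
by have := sqr_ge0 (2 * y 0%N - S); lra.
Qed.

Let b k : R := level_mean k (Num.truncn lambda).

Let a L : R := \sum_(k < L) b k.

Lemma measurable_disc (V : T -> nat) (r : nat -> R) : disc V ->
  measurable_fun setT (fun t => r (V t)).
Proof. by move=> dV _ B mB; rewrite setTI; exact: (disc_comp r dV B). Qed.

Lemma disc_trunc_cost L : disc (trunc_cost L).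
Proof.
have h : disc (fun t => [seq cost_at N X J L (level_cost L k) t | k <- iota 0 L]).
  elim: (iota 0 L) => [|k s IH]; first exact: (disc_cst [::]).
  apply: (disc_dep (H := fun c t => c :: _)); first exact: disc_cost_at.
  by move=> c; exact: (disc_comp (cons c)) IH.
have := disc_comp (fun s => sumn s) h; congr disc; apply/funext => t /=.
by rewrite sumnE big_map /trunc_cost -(big_mkord xpredT (fun k => cost_at N X J L (level_cost L k) t)) /index_iota subn0.
Qed.

Lemma integral_trunc_cost L :
  (\int[P]_t (((trunc_cost L t)%:R - a L) ^+ 2)%:E <= (2484 * lambda ^+ 2)%:E)%E.
Proof.
pose y k t : R := (cost_at N X J L (level_cost L k) t)%:R - b k.
have my k : measurable_fun setT (fun t => (y k t ^+ 2)%:E).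
  apply/measurable_EFinP.
  exact: (measurable_disc (fun c => (c%:R - b k) ^+ 2) (disc_cost_at _ _ _ _ _)).
have c0 k : 0 <= 3 * (3 / 2) ^+ k :> R by rewrite mulr_ge0// exprn_ge0// divr_ge0.
apply: (@le_trans _ _ (\int[P]_t (\sum_(k < L) ((3 * (3 / 2) ^+ k)%:E * (y k t ^+ 2)%:E)))%E).
  apply: ge0_le_integral => //.
  - by move=> t _; rewrite lee_fin sqr_ge0.
  - apply/measurable_EFinP; exact: (measurable_disc (fun c => (c%:R - a L) ^+ 2) (disc_trunc_cost L)).
  - by apply: emeasurable_sum => k; exact: measurable_funeM.
  - move=> t _; rewrite -(eq_bigr _ (fun k _ => EFinM _ _)) sumEFin lee_fin.
    by rewrite /a /trunc_cost natr_sum -sumrB; exact: (sqr_sum_le (y ^~ t)).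
rewrite ge0_integral_sum//; first last.
- by move=> k t _; rewrite mule_ge0// lee_fin ?sqr_ge0.
- by move=> k; exact: measurable_funeM.
(* 621 = 3 * 207 and (3/2)^k 2^-k = (3/4)^k, whose sum is below 4; 2484 = 4 * 621. *)
apply: (@le_trans _ _ (\sum_(k < L) (621 * (3 / 4) ^+ k * lambda ^+ 2)%:E)%E).
  apply: lee_sum => k _; rewrite ge0_integralZl_EFin//; last first.
    by move=> t _; rewrite lee_fin sqr_ge0.
  have := integral_level_cost lambda_gt0 N_pois X_unif J_uord src_indep (ltnW (ltn_ord k)).
  rewrite -/(b k) => h.
  apply: (@le_trans _ _ ((3 * (3 / 2) ^+ k)%:E * (207 * (2 ^ k)%:R^-1 * lambda ^+ 2)%:E)%E).
    by apply: lee_wpmul2l => //; rewrite lee_fin.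
  rewrite -EFinM lee_fin le_eqVlt; apply/orP; left; apply/eqP.
  have -> : (3 / 4 : R) = 3 / 2 / 2 by field.
  by rewrite [(3 / 2 / 2) ^+ k]exprMn exprVn natrX; ring.
rewrite sumEFin lee_fin -mulr_suml -mulr_sumr.
rewrite ler_wpM2r ?sqr_ge0//.
suff : \sum_(k < L) (3 / 4) ^+ k <= 4 :> R by lra.
have -> : \sum_(k < L) (3 / 4) ^+ k = 4 * (1 - (3 / 4) ^+ L) :> R.
  elim: (L) => [|l IH]; first by rewrite big_ord0 expr0 subrr mulr0.
  by rewrite big_ord_recr/= IH exprS; field.
have : 0 <= (3 / 4) ^+ L :> R by rewrite exprn_ge0// divr_ge0.
lra.
Qed.

Lemma level_mean0 k : level_mean k 0 = 0 :> R.
Proof. by rewrite /level_mean/= mean_cost0 mulr0. Qed.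

Lemma sqr_level_mean_le k n : level_mean k n ^+ 2 <= 12 * n%:R ^+ 3 * (2 ^ k)%:R^-1 :> R.
Proof.
have q0 : 0 <= (2 ^ k)%:R^-1 :> R by rewrite invr_ge0.
have := sqr_diff_growth (mulr_ge0 _ q0) (sqr_diff_level_mean (R := R) k) n 0.
rewrite level_mean0 !subr0 addr0 => /(_ (ler0n _ _)) /le_trans; apply.
have n0 : 0 <= n%:R ^+ 2 :> R by exact: sqr_ge0.
have := mulr_ge0 q0 n0; lra.
Qed.

(** The estimates at level L have the centre [a L], whereas a variance bound needs one fixed centre:
    the limit. The ratio 3/4 works because (3/4)^2 = 9/16 exceeds 1/2, and 12 n^3 <= 16 n^4. *)
Lemma is_cvg_level_mean n : cvgn (series (fun k => level_mean k n : R)).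
Proof.
have geo0 k : 0 <= 4 * n%:R ^+ 2 * (3 / 4) ^+ k :> R.
  apply: mulr_ge0; first by apply: mulr_ge0 => //; exact: sqr_ge0.
  by apply: exprn_ge0; exact: divr_ge0.
apply: normed_cvg; apply: (@series_le_cvg _ _ (geometric (4 * n%:R ^+ 2) (3 / 4))).
- by move=> k; exact: normr_ge0.
- by move=> k; exact: geo0.
- move=> k; rewrite /geometric/= -ler_sqr ?nnegrE//.
  rewrite real_normK ?num_real// (le_trans (sqr_level_mean_le k n))//.
  rewrite exprMn -exprM mulnC exprM.
  have h : (2 ^ k)%:R^-1 <= ((3 / 4) ^+ 2) ^+ k :> R.
    by rewrite natrX -exprVn lerXn2r ?nnegrE ?exprn_ge0 ?divr_ge0//; lra.
  apply: le_trans (ler_wpM2l (sqr_ge0 _) h).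
  rewrite ler_wpM2r ?invr_ge0//.
  case: n {geo0} => [|n]; first by rewrite !expr0n/= !mulr0 expr0n.
  have : 1 <= n.+1%:R :> R by rewrite ler1n.
  set z := n.+1%:R => z1; have z3' : 0 <= z ^+ 3 by rewrite exprn_ge0.
  have z3 : 0 <= z ^+ 3 * (z - 1) by rewrite mulr_ge0// subr_ge0.
  lra.
- by apply: is_cvg_geometric_series; rewrite ger0_norm ?divr_ge0//; lra.
Qed.

Lemma variance_bit_comparisons_le :
  ('V_P[quicksort_bit_comparisons N X J] <= (2484 * lambda ^+ 2)%:E)%E.
Proof.
have [mbad bad0] := bad_null.
pose B := quicksort_bit_comparisons N X J.
(* Set to 0 on the null set, the cost becomes an everywhere limit of measurable functions. *)
pose B' t : R := if t \in bad then 0 else B t.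
have B0 t : 0 <= B t by exact: ler0n.
have B'0 t : 0 <= B' t by rewrite /B'; case: ifP.
have BB' t : ~ bad t -> B t = B' t by move=> gt; rewrite /B' memNset.
rewrite (eq_variance_off_null mbad bad0 B0 B'0 BB').
have cvg_trunc t : ~ bad t -> (fun L => (trunc_cost L t)%:R : R) @ \oo --> B' t.
  move=> gt; have [L0 hL0] := good_trunc_cost gt.
  apply: cvg_near_cst; exists L0 => // L /= hL; apply/esym.
  by rewrite -BB'// /B (hL0 _ hL).
have mW L : measurable_fun setT (fun t => (trunc_cost L t)%:R : R).
  exact: (measurable_disc (fun c => c%:R) (disc_trunc_cost L)).
have mB' : measurable_fun setT B'.
  apply: (@measurable_fun_cvg _ _ _ setT (fun L t => (trunc_cost L t)%:R * \1_(~` bad) t)).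
    move=> L; apply: measurable_funM => //.
    by apply: measurable_indic; exact: measurableC.
  move=> t _; rewrite indicE; have [tb|gt] := pselect (bad t).
    rewrite /B' (mem_set tb) memNset; last by move=> /(_ tb).
    by under eq_fun do rewrite mulr0; exact: cvg_cst.
  rewrite (mem_set (gt : (~` bad) t)); under eq_fun do rewrite mulr1; exact: cvg_trunc.
pose l := limn a.
have al : a @ \oo --> l.
  have := @is_cvg_level_mean (Num.truncn lambda); rewrite /l.
  rewrite (_ : series _ = a); first by [].
  by apply/funext => L; rewrite /series/= /a big_mkord.
apply: (variance_le_sqr_dev (a := l)) => //.
pose g L t := (((trunc_cost L t)%:R - a L) ^+ 2)%:E : \bar R.
have mg L : measurable_fun setT (g L).
  apply/measurable_EFinP.
  exact: (measurable_disc (fun c => (c%:R - a L) ^+ 2) (disc_trunc_cost L)).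
have g0 L t : (0 <= g L t)%E by rewrite lee_fin sqr_ge0.
(* Off [bad] the squared deviations converge, so the lower limit there is (B' - l)^2; Fatou's lemma
   then bounds its integral uniformly. *)
apply: (@le_trans _ _ (\int[P]_t limn_einf (g ^~ t))%E).
  apply: (ge0_le_integral_off_null mbad bad0).
  - by move=> t; rewrite lee_fin sqr_ge0.
  - move=> t; rewrite limn_einf_lim; apply: lime_ge; first exact: is_cvg_einfs.
    by apply: nearW => n; apply: le_ereal_inf_tmp => _ [m _ <-].
  move=> t gt; have cg : g ^~ t @ \oo --> ((B' t - l) ^+ 2)%:E.
    apply: cvg_EFin; first by apply: nearW.
    apply: (@cvg_comp _ _ _ _ (fun x => x ^+ 2) _ (nbhs (B' t - l))).
      by apply: cvgB => //; exact: cvg_trunc.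
    exact: exprn_continuous.
  by rewrite is_cvg_limn_einfE; [rewrite (cvg_lim _ cg)|exact: cvgP cg].
apply: (le_trans (fatou P measurableT mg (fun L t _ => g0 L t))).
rewrite limn_einf_lim; apply: lime_le; first exact: is_cvg_einfs.
apply: nearW => L; apply: le_trans (integral_trunc_cost L).
by apply: ereal_inf_lbound; exists L => //; exact: leqnn.
Qed.

End BitComparisonsVariance.

Theorem proposition5p6 (R : realType) :
  exists c : R,
  forall (lambda : R) (d : measure_display) (T : measurableType d)
    (P : probability T R) (N : {RV P >-> nat}) (X : nat -> {RV P >-> R})
    (J : seq bool -> nat -> {RV P >-> nat}),
  0 < lambda ->
  poisson_distributed lambda N ->
  (forall i : nat, uniform01 (X i)) ->
  (forall (w : seq bool) (n : nat), (2 <= n)%N -> uniform_ord n (J w n)) ->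
  independent_classes P (sources N X J) ->
  ('V_P[quicksort_bit_comparisons N X J] <= (c ^+ 2 * lambda ^+ 2)%:E)%E.
Proof.
(* 50^2 = 2500 exceeds 2484. *)
exists 50 => lambda d T P N X J lambda0 Np Xu Ju ind.
apply: le_trans (variance_bit_comparisons_le lambda0 Np Xu Ju ind) _.
rewrite lee_fin ler_wpM2r ?sqr_ge0//; lra.
Qed.
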